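(* Let $p = p(n)$ be a function of $n \in \mathbb{N}$, let $q_0 = q_0^{(n)} \in \Delta_p$ be a sequence of probability vectors with $q_0(1) \geq \dots \geq q_0(p) \geq \frac{1}{n}$ for all $n$, and let $\{\alpha_p\}$ be a sequence with $\alpha_p \to \infty$ as $n \to \infty$. Let $n' = (1 + c_n)n$ with $c_n = n^{-1/3}$, $$j^* = \arg\max_{1 \leq j \leq p-1} q_0^{-\max}(j)(1-q_0^{-\max}(j))\, h^{-1}\left(\frac{\log(ej\alpha_p\log^2(ej))}{n'q_0^{-\max}(j)(1-q_0^{-\max}(j))}\right),$$ $$\epsilon = \xi \cdot \max_{1 \leq j \leq p-1} q_0^{-\max}(j)(1-q_0^{-\max}(j))\, h^{-1}\left(\frac{\log(ej)}{n'q_0^{-\max}(j)(1-q_0^{-\max}(j))}\right),$$ where $\xi > 0$ is a fixed constant not depending on $n$. Suppose that, as $n \to \infty$, $$\frac{\log j^*}{(\log\alpha_p)(\log\log j^* )} \to \infty \quad\text{and}\quad \frac{\epsilon}{\sqrt{\frac{q_0^{\max}(1-q_0^{\max})}{n}}} \to \infty.$$ Then, as $n \to \infty$: (i) Suppose $\xi > 1$. If $\frac{\log j^*}{nq_0^{-\max}(j^* )} \to 0$ or $\frac{\log j^*}{nq_0^{-\max}(j^* )} \to \infty$, then $\mathcal{R}_{\mathcal{M}}(\epsilon,n,q_0) \to 0$. (ii) Suppose $\xi < 1$. If $\frac{\log j^*}{nq_0^{-\max}(j^* )} \to 0$ or $\frac{\log j^*}{nq_0^{-\max}(j^* )} \to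 \infty$, then $\mathcal{R}_{\mathcal{M}}(\epsilon,n,q_0) \to 1$.
   Context: $\Delta_p = \{\pi \in [0,1]^p : \sum_{j=1}^p \pi(j) = 1\}$. $q_0^{\max} = \max_j q_0(j) = q_0(1)$ and $q_0^{-\max} = (q_0(2),\dots,q_0(p)) \in [0,1]^{p-1}$, so $q_0^{-\max}(j) = q_0(j+1)$. The function $h : [-1,\infty) \to \mathbb{R}$ is defined by $h(-1) = 1$ and $h(x) = (1+x)\log(1+x) - x$ for $x > -1$; $h^{-1} : [0,\infty) \to [0,\infty)$ is the inverse of $h$ restricted to $[0,\infty)$. All quantities depend on $n$, and the definitions are considered for all $n$ large enough that they make sense; $j^*$ is a maximizer. For $q \in \Delta_p$, $P_q$ is the law of $X \sim \mathrm{Multinomial}(n,q)$; $\Pi(q_0,\varepsilon) = \{q \in \Delta_p : \|q - q_0\|_\infty \geq \varepsilon\}$ with $\|v\|_\infty = \max_j|v_j|$. The minimax testing risk is $$\mathcal{R}_{\mathcal{M}}(\varepsilon,n,q_0) = \inf_\varphi\left\{P_{q_0}\{\varphi = 1\} + \sup_{q \in \Pi(q_0,\varepsilon)} P_q\{\varphi = 0\}\right\},$$ the infimum being over all measurable $\{0,1\}$-valued functions $\varphi = \varphi(X)$. *)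

(* Defs.v *)
From mathcomp Require Import all_boot all_order all_algebra.
From mathcomp Require Import all_classical all_reals all_analysis.

Set Implicit Arguments.
Unset Strict Implicit.
Unset Printing Implicit Defensive.

Import Order.TTheory GRing.Theory Num.Theory.
Import numFieldNormedType.Exports.

Local Open Scope classical_set_scope.
Local Open Scope ring_scope.

Section Defs.
Context {R : realType}.

Definition simplex (p : nat) : set 'rV[R]_p :=
  [set q : 'rV[R]_p | (forall j, 0 <= q 0 j <= 1) /\ \sum_j q 0 j = 1].

(* P_q {X in A} for X ~ Multinomial(n, q). The sample space {0,...,n}^p is
   finite and discrete, so every event, and every test, is measurable. *)
Definition multinomial_pmf (n p : nat) (q : 'rV[R]_p)
    (x : {ffun 'I_p -> 'I_n.+1}) : R :=
  if (\sum_j x j == n)%N then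
    n`!%:R / (\prod_j (x j)`!)%N%:R * \prod_j q 0 j ^+ x j
  else 0.

Definition multinomial_prob (n p : nat) (q : 'rV[R]_p)
    (A : pred {ffun 'I_p -> 'I_n.+1}) : R :=
  \sum_(x | A x) multinomial_pmf q x.

(* `|_| on row vectors is the sup norm. *)
Definition alternatives (p : nat) (q0 : 'rV[R]_p) (eps : R) : set 'rV[R]_p :=
  [set q : 'rV[R]_p | simplex q /\ eps <= `|q - q0|].

(* If there are no alternatives, the second term is sup set0 = 0. *)
Definition test_risk (n p : nat) (q0 : 'rV[R]_p) (eps : R)
    (phi : {ffun 'I_p -> 'I_n.+1} -> bool) : R :=
  multinomial_prob q0 [pred x | phi x] +
  sup [set multinomial_prob q [pred x | ~~ phi x] | q in alternatives q0 eps].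

Definition minimax_risk (eps : R) (n p : nat) (q0 : 'rV[R]_p) : R :=
  inf [set test_risk q0 eps phi |
        phi in [set: {ffun 'I_p -> 'I_n.+1} -> bool]].

(* Only the values on [-1, +oo[ matter. *)
Definition h (x : R) : R :=
  if x == -1 then 1 else (1 + x) * ln (1 + x) - x.

Definition hinv : R -> R := 'pinv_(fun=> 0) `[0, +oo[ h.

Definition qmax (p : nat) (q : 'rV[R]_p) : R := \big[Num.max/0]_j q 0 j.

(* q^{-max}(j) = q(j+1) for 1 <= j <= p-1, with j and the arguments of q
   counted from 1. As row vectors are indexed from 0, this is coordinate j
   of q; the value for j >= p is never used. *)
Definition qminus (p : nat) (q : 'rV[R]_p) (j : nat) : R :=
  if insub j is Some i then q 0 i else 0.

Definition nprime (n : nat) : R := (1 + n%:R `^ (- (1 / 3))) * n%:R.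

(* v (1 - v) h^{-1}(y / (n' v (1 - v))) *)
Definition hscale (n : nat) (v y : R) : R :=
  v * (1 - v) * hinv (y / (nprime n * v * (1 - v))).

Definition jstar_objective (n p : nat) (q0 : 'rV[R]_p) (alpha : R)
    (j : nat) : R :=
  let ej := expR 1 * j%:R in
  hscale n (qminus q0 j) (ln (ej * alpha * ln ej ^+ 2)).

Definition is_jstar (n p : nat) (q0 : 'rV[R]_p) (alpha : R) (j : nat) : Prop :=
  (1 <= j < p)%N /\
  forall k, (1 <= k < p)%N ->
    jstar_objective n q0 alpha k <= jstar_objective n q0 alpha j.

(* The maximum runs over nonnegative terms, so the default 0 is harmless. *)
Definition epsilon (xi : R) (n p : nat) (q0 : 'rV[R]_p) : R :=
  xi * \big[Num.max/0]_(1 <= j < p)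
         hscale n (qminus q0 j) (ln (expR 1 * j%:R)).

End Defs.

(* Main.v *)
Require Import Defs.
From mathcomp Require Import all_boot all_order all_algebra.
From mathcomp Require Import all_classical all_reals all_analysis.
From mathcomp Require Import ring lra zify.
Import Order.TTheory GRing.Theory Num.Theory.
Import numFieldNormedType.Exports.
Local Open Scope classical_set_scope.
Local Open Scope ring_scope.

(** Write v_j = q0(j)(1 - q0(j)), V = qmax (1 - qmax) and, for the radius eps,
G = n eps^2 / (2 (2 V + 3 eps)).  The hypothesis that eps dominates
sqrt (V / n) means that G tends to infinity; this controls the largest coordinate
and the coordinates moved by an alternative.

The two maxima compared in the statement, with log (e j) and with
log (e j alpha log^2 (e j)), are asymptotically equal.  At j* the second
logarithm is (1 + o(1)) times the first, by the hypothesis on log j*; as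
h (c x) <= c h x for 0 <= c <= 1, the inverse satisfies
hinv (c y) <= c hinv y for c >= 1, so the relative error is not amplified
([hscale_mulr_le]).  Hence for xi > 1 the radius exceeds all the detection
thresholds by a constant factor, and for xi < 1 it is a constant factor below
the threshold v hinv (log (e j* ) / (n' v)) with v = v_(j* ).

Risk tending to 0.  Reject when some |X_j / n - q0(j)| reaches s eps, with
1/xi < s < 1.  Bennett's inequality bounds the probability that coordinate
j > 0 causes a false rejection by 2 / (e j alpha log^2 (e j)), whose sum over j
is O(1 / alpha).  The false rejections caused by the largest coordinate, and
the failure to reject when |q(j) - q0(j)| >= eps, cost O(exp (- c G))
([minimax_risk_upper_finite]).

Risk tending to 1.  Spread the alternative over J = (j*/2, j*]: the i-th spike
raises q0(i) by eps and scales all the other coordinates, so its likelihood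
ratio LR_i depends on X_i only.  For i <> j one has E0[LR_i LR_j] <= 1, so that
the second moment of the average of the LR_i is 1 plus a diagonal part.  The
diagonal part alone may explode, but it does not once LR_i is restricted to
X_i <= n (q0(i) + (1 + eta) eps), an event of probability 1 - O(exp (- c G))
under the spike.  There LR_i is at most exp ((1 + o(1)) n q0(i) h (eps / q0(i)))
and, by the convexity of h, n q0(i) h (eps / q0(i)) <= xi' log (e j* ) for a
constant xi' < 1.  So this part of LR_i is at most o(#|J|), the truncated average
is close to 1 in mean square, and no test separates the null from the mixture
([minimax_risk_lower_finite]). *)

(** * The rate function h and its inverse *)

Section HFun.
Context {R : realType}.
Implicit Types x y c : R.

Lemma hE x : -1 < x -> h x = (1 + x) * ln (1 + x) - x.
Proof. by move=> x1; rewrite /h gt_eqF. Qed.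

Lemma ln_le_sub1 x : 0 < x -> ln x <= x - 1.
Proof.
move=> x0; by rewrite -{1}(subrKC 1 x) le_ln1Dx//; lra.
Qed.

Lemma ln_ge_1subV x : 0 < x -> 1 - x^-1 <= ln x.
Proof.
move=> x0; have := ln_le_sub1 (x^-1).
rewrite invr_gt0 => /(_ x0); rewrite lnV ?posrE//; lra.
Qed.

(** Applying ln s >= 1 - 1/s at s = sqrt (1 + x), instead of at 1 + x, gives the
correct order of ln (1 + x) at 0 and is enough for all bounds on h below. *)
Lemma ln1D_sqrt x : 0 <= x -> 
  let s := Num.sqrt (1 + x) in
  [/\ 1 <= s, x = s ^+ 2 - 1 & 2 * (s - 1) <= s * ln (1 + x)].
Proof.
move=> x0 s.
have x1 : 0 <= 1 + x by lra.
have ss : s ^+ 2 = 1 + x by rewrite sqr_sqrtr.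
have s1 : 1 <= s by rewrite -[leLHS](@sqrtr1 R) ler_sqrt; lra.
have s0 : 0 < s by lra.
split=> //; first by rewrite ss; lra.
have := ler_wpM2l (ltW s0) (ln_ge_1subV _ s0).
rewrite mulrBr mulr1 mulfV ?gt_eqF// -ss lnXn// -mulr_natl; lra.
Qed.

(** Bernstein's lower bound, up to the constant: quadratic near 0 and linear at
infinity.  In terms of s = sqrt (1 + x), h x >= (s - 1)^2. *)
Lemma h_ge x : 0 <= x -> x ^+ 2 / (2 * (2 + x)) <= h x.
Proof.
move=> x0; rewrite hE; last by lra.
have [s1 xs L] := ln1D_sqrt x x0; move: (Num.sqrt _) s1 xs L => s s1 xs L.
rewrite ler_pdivrMr; last by lra.
have {}L : (s - 1) ^+ 2 <= (1 + x) * ln (1 + x) - x.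
  move: (ln (1 + x)) L => l L.
  have : s * (2 * (s - 1)) <= s * (s * l) by rewrite ler_pM2l//; lra.
  by rewrite xs; lra.
apply: le_trans (ler_wpM2r _ L); last lra.
rewrite xs.
have -> : (s ^+ 2 - 1) ^+ 2 = (s - 1) ^+ 2 * (s + 1) ^+ 2 by ring.
apply: ler_wpM2l; first exact: sqr_ge0.
have := sqr_ge0 (s - 1); nra.
Qed.

Lemma mul_ln1D_le x : 0 <= x -> x * ln (1 + x) <= 4 * h x.
Proof.
move=> x0; rewrite hE; last by lra.
have [s1 xs L] := ln1D_sqrt x x0; move: (Num.sqrt _) s1 xs L => s s1 xs L.
have s0 : 0 < s by lra.
rewrite -(ler_pM2l s0).
have : 2 * (s - 1) * (3 * x + 4) <= s * ln (1 + x) * (3 * x + 4).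
  by apply: ler_wpM2r L; lra.
move: (ln (1 + x)) => l Hl.
have : 4 * x * s <= 2 * (s - 1) * (3 * x + 4).
  rewrite xs -subr_ge0.
  have -> : 2 * (s - 1) * (3 * (s ^+ 2 - 1) + 4) - 4 * (s ^+ 2 - 1) * s =
     2 * (s - 1) ^+ 3 by ring.
  by rewrite mulr_ge0// exprn_ge0//; lra.
lra.
Qed.

Lemma h_gt0 x : 0 < x -> 0 < h x.
Proof.
move=> x0; apply: lt_le_trans (h_ge _ (ltW x0)).
by rewrite divr_gt0 ?exprn_gt0//; lra.
Qed.

Lemma h0 : h 0 = 0 :> R.
Proof. by rewrite hE ?ltrN10// addr0 ln1 mulr0 subr0. Qed.

Lemma h_ge0 x : 0 <= x -> 0 <= h x.
Proof. by rewrite le_eqVlt => /predU1P[<-|/h_gt0/ltW//]; rewrite h0. Qed.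

(** h is convex and vanishes at 0.  Convexity comes from the tangent of y ln y at
w = 1 + c x, which is used at the points y = 1 + x and y = 1. *)
Lemma h_scale_le c x : 0 <= c <= 1 -> 0 <= x -> h (c * x) <= c * h x.
Proof.
move=> /andP[c0 c1] x0.
have cx0 : 0 <= c * x by rewrite mulr_ge0.
rewrite !hE; [|lra..].
set w := 1 + c * x; set y := 1 + x.
have w0 : 0 < w by rewrite /w; lra.
have y0 : 0 < y by rewrite /y; lra.
have ew : w = c * y + (1 - c) by rewrite /w /y; ring.
have tangent : y * ln w + (y - w) <= y * ln y.
  have : y * ln (w / y) <= y * (w / y - 1).
    by rewrite ler_pM2l// ln_le_sub1// divr_gt0.
  rewrite mulrBr mulr1 mulrCA mulfV ?gt_eqF// mulr1 ln_div ?posrE//; lra.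
have L1 : 1 - w <= - ln w by rewrite lerNr opprB ln_le_sub1.
have T1 := ler_wpM2l c0 tangent.
have T2 : (1 - c) * (1 - w) <= (1 - c) * (- ln w) by rewrite ler_wpM2l//; lra.
have E1 : c * (y - w) + (1 - c) * (1 - w) = 0 by rewrite ew; ring.
suff : w * ln w <= c * (y * ln y) by rewrite /w /y; lra.
rewrite {1}ew; move: E1 T1 T2; lra.
Qed.

Lemma h_lt x y : 0 <= x -> x < y -> h x < h y.
Proof.
move=> x0 xy; have y0 : 0 < y by lra.
have := h_scale_le (x / y) y; rewrite divfK ?gt_eqF//.
rewrite divr_ge0 ?ler_pdivrMr//= ?mul1r; [|lra..].
move=> /(_ (ltW xy) (ltW y0))/le_lt_trans; apply.
by rewrite gtr_pMl ?h_gt0// ltr_pdivrMr// mul1r.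
Qed.

Lemma h_le x y : 0 <= x -> x <= y -> h x <= h y.
Proof. by move=> x0; rewrite le_eqVlt => /predU1P[->//|/(h_lt _ _ x0)/ltW]. Qed.

Lemma hinvP y : 0 <= y -> 0 <= hinv y /\ h (hinv y) = y.
Proof.
move=> y0; rewrite /hinv.
have : (h @` `[0, +oo[) y.
  have [] := @IVT R h 0 (y + y + 4) y.
  - lra.
  - apply: (@subspace_eq_continuous _ _ _ (fun x => (1 + x) * ln (1 + x) - x)).
      move=> x; rewrite inE/= in_itv/= => /andP[x0 _].
      rewrite /from_subspace /= (hE x)//; lra.
    apply: continuous_in_subspaceT => x; rewrite inE/= in_itv/= => /andP[x0 _].
    apply: cvgB; last exact: cvg_id.
    have c1 : 1 + x0 @[x0 --> x] --> 1 + x by apply: cvgD; [exact: cvg_cst|exact: cvg_id].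
    apply: cvgM => //.
    have x1 : 0 < 1 + x by lra.
    have c2 : ln u @[u --> 1 + x] --> ln (1 + x) by exact: continuous_ln.
    exact: (cvg_comp _ _ c1 c2).
  - have H : y <= h (y + y + 4).
      apply: le_trans (h_ge _ _); last lra.
      rewrite ler_pdivlMr; last lra.
      nra.
    by rewrite h0 min_l ?max_r//; [rewrite y0 H|lra..].
  move=> c; rewrite in_itv/= => /andP[c0 _] hc.
  by exists c => //=; rewrite in_itv/= c0.
move=> im; split.
  have := @surjpinv_image_sub _ _ (fun=> 0) `[0, +oo[ _ (h : R -> R) (@subset_refl _ _).
  by move=> /(_ _ (imageP _ im)) /=; rewrite in_itv/= andbT.
exact: (pinvK (fun=> 0) (mem_set im)).
Qed.

End HFun.

(** * The multinomial distribution *)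

Section Multinomial.
Context {R : realType}.
Variables n p : nat.
Local Notation pmf := (@multinomial_pmf R n p).
Local Notation prob := (@multinomial_prob R n p).
Implicit Types (q : 'rV[R]_p) (f : 'I_p -> R) (x : {ffun 'I_p -> 'I_n.+1}).

(** The polynomial with coefficients a^m / m! for m <= n is the exponential of
a 'X modulo 'X^(n+1), so a product of such polynomials is the exponential of
the sum: the coefficient of degree i <= n is the binomial theorem. *)
Lemma coef_prod_truncated_exp (a : 'I_p -> R) (r : seq 'I_p) i : (i <= n)%N ->
  (\prod_(k <- r) \poly_(m < n.+1) (a k ^+ m / m`!%:R))`_i =
  (\sum_(k <- r) a k) ^+ i / i`!%:R.
Proof.
elim: r i => [|k r IH] i le_in.
  by rewrite !big_nil coef1 expr0n; case: eqP => [->|]; rewrite ?fact0 ?divr1 ?mul0r.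
rewrite !big_cons coefM addrC exprDn mulr_suml; apply: eq_bigr => j _.
have le_ji : (j <= i)%N by rewrite -ltnS.
rewrite coef_poly ltnS (leq_trans le_ji le_in) IH;
  last exact: leq_trans (leq_subr _ _) le_in.
rewrite -mulr_natr -(bin_fact le_ji) !natrM.
have F m : m`!%:R != 0 :> R by rewrite pnatr_eq0 -lt0n fact_gt0.
have B : 'C(i, j)%:R != 0 :> R by rewrite pnatr_eq0 -lt0n bin_gt0.
by field; rewrite !F B.
Qed.

(** The multinomial theorem: both sides are n! times the coefficient of degree n
in the product of the truncated exponentials of (q k * f k) 'X.  All moments
used later are instances of this identity. *)
Lemma multinomial_mgf q f :
  \sum_x pmf q x * \prod_k f k ^+ x k = (\sum_k q 0 k * f k) ^+ n.
Proof.
have F m : m`!%:R != 0 :> R by rewrite pnatr_eq0 -lt0n fact_gt0.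
pose a k := q 0 k * f k.
have := coef_prod_truncated_exp a (index_enum _) n (leqnn n).
move=> /(congr1 (fun z => n`!%:R * z)); rewrite mulrCA mulfV// mulr1 => <-.
under eq_bigr do rewrite poly_def.
rewrite bigA_distr_bigA/= coef_sum mulr_sumr; apply: eq_bigr => x _.
rewrite scaler_prod prodrXr coefZ coefXn /multinomial_pmf eq_sym.
case: eqP => _; last by rewrite mul0r !mulr0.
rewrite mulr1 natr_prod prodf_div -!mulrA; congr (_ * _).
rewrite mulrC; congr (_ * _); rewrite -big_split/=.
by apply: eq_bigr => k _; rewrite exprMn.
Qed.

Lemma multinomial_sum1 q : \sum_k q 0 k = 1 -> \sum_x pmf q x = 1.
Proof.
move=> q1; have E : \sum_k q 0 k * 1 = 1.
  by rewrite -[RHS]q1; apply: eq_bigr => k _; rewrite mulr1.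
have := multinomial_mgf q (fun=> 1); rewrite E expr1n => <-.
by apply: eq_bigr => x _; rewrite big1 ?mulr1// => k _; rewrite expr1n.
Qed.

Lemma multinomial_pmf_ge0 q x : (forall k, 0 <= q 0 k) -> 0 <= pmf q x.
Proof.
move=> q0; rewrite /multinomial_pmf; case: ifP => // _.
by rewrite mulr_ge0 ?divr_ge0 ?ler0n// prodr_ge0// => k _; rewrite exprn_ge0.
Qed.

Lemma multinomial_pmf_supp q x : (\sum_j x j != n)%N -> pmf q x = 0.
Proof. by rewrite /multinomial_pmf => /negbTE ->. Qed.

(** Change of measure: the density of one multinomial law with respect to
another one. *)
Lemma multinomial_pmf_mul q f x :
  pmf (\row_k (q 0 k * f k)) x =
  pmf q x * \prod_k f k ^+ x k.
Proof.
rewrite /multinomial_pmf; case: ifP => _; last by rewrite mul0r.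
rewrite -[RHS]mulrA; congr (_ * _); rewrite -big_split/=.
by apply: eq_bigr => k _; rewrite mxE exprMn.
Qed.

Lemma multinomial_prob_ge0 q A : (forall k, 0 <= q 0 k) -> 0 <= prob q A.
Proof. by move=> q0; apply: sumr_ge0 => x _; exact: multinomial_pmf_ge0. Qed.

Lemma multinomial_prob_le q (A B : pred {ffun 'I_p -> 'I_n.+1}) :
  (forall k, 0 <= q 0 k) -> {subset A <= B} ->
  prob q A <= prob q B.
Proof.
move=> q0 AB; rewrite /multinomial_prob [leRHS](bigID A)/=.
rewrite (eq_bigl (fun x => B x && A x)).
  by rewrite lerDl sumr_ge0// => x _; exact: multinomial_pmf_ge0.
by move=> x; case: (boolP (A x)) => [/AB|]; rewrite ?andbT ?andbF// => ->.
Qed.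

Lemma multinomial_prob_le1 q A : simplex q -> prob q A <= 1.
Proof.
move=> [q01 q1]; rewrite -(multinomial_sum1 q q1).
have q0 k : 0 <= q 0 k by have /andP[] := q01 k.
exact: (@multinomial_prob_le q A predT).
Qed.

(** Markov's inequality for a product of one-coordinate powers, the form taken by
exponential moments. *)
Lemma multinomial_markov q f (A : pred {ffun 'I_p -> 'I_n.+1}) :
  (forall k, 0 <= q 0 k) -> (forall k, 0 <= f k) ->
  (forall x, A x -> (\sum_j x j = n)%N -> 1 <= \prod_k f k ^+ x k) ->
  prob q A <= (\sum_k q 0 k * f k) ^+ n.
Proof.
move=> q0 f0 Af; rewrite -multinomial_mgf.
rewrite [leRHS](bigID A)/= -[leLHS]addr0 lerD//; last first.
  apply: sumr_ge0 => x _; rewrite mulr_ge0 ?multinomial_pmf_ge0//.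
  by apply: prodr_ge0 => k _; exact: exprn_ge0.
apply: ler_sum => x Ax.
case: (eqVneq (\sum_j x j)%N n) => [xn|/(multinomial_pmf_supp q) ->]; last by rewrite mul0r.
by rewrite ler_peMr ?multinomial_pmf_ge0// Af.
Qed.

End Multinomial.

(** * Bennett and Bernstein inequalities for one coordinate *)

Section Bennett.
Context {R : realType}.

(** The comparison behind Bennett's inequality.  It holds term by term in the
exponential series, because |y| <= 1 gives y^k <= y^2 for k >= 2. *)
Lemma expR_sub_affine_le (y t : R) : `|y| <= 1 -> 0 <= t ->
  expR (t * y) - 1 - t * y <= y ^+ 2 * (expR t - 1 - t).
Proof.
move=> y1 t0.
pose S x N := series (exp_coeff x) N : R.
have cS x : S x N @[N --> \oo] --> expR x.
  by rewrite /expR; apply: is_cvg_series_exp_coeff.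
have S2 x : S x 2 = 1 + x.
  by rewrite /S /series/= !big_nat_recr//= big_geq// add0r /exp_coeff/= expr0 expr1 !divr1.
have le_S N : S (t * y) N.+2 - 1 - t * y <= y ^+ 2 * (S t N.+2 - 1 - t).
  elim: N => [|N IH]; first by rewrite !S2; lra.
  have SS x : S x N.+3 = S x N.+2 + x ^+ N.+2 / (N.+2)`!%:R.
    by rewrite /S /series/= big_nat_recr.
  rewrite !SS.
  have : (t * y) ^+ N.+2 / (N.+2)`!%:R <= y ^+ 2 * (t ^+ N.+2 / (N.+2)`!%:R).
    rewrite mulrA ler_wpM2r ?invr_ge0// exprMn mulrC ler_wpM2r ?exprn_ge0//.
    rewrite -addn2 exprD ler_piMl ?sqr_ge0//.
    by rewrite (le_trans (ler_norm _))// normrX exprn_ile1.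
  lra.
apply: (@ler_cvg_to _ \oo _ _ (fun N => S (t * y) N - 1 - t * y)
  (fun N => y ^+ 2 * (S t N - 1 - t))).
- by do 2 (apply: cvgB; last exact: cvg_cst); exact: cS.
- apply: cvgM; first exact: cvg_cst.
  by do 2 (apply: cvgB; last exact: cvg_cst); exact: cS.
- by exists 2%N => //= -[|[|N]] //= _; exact: le_S.
Qed.

Section Tail.
Variables n p : nat.
Local Notation pmf := (@multinomial_pmf R n p).
Local Notation prob := (@multinomial_prob R n p).
Implicit Types (q : 'rV[R]_p) (x : {ffun 'I_p -> 'I_n.+1}).

Lemma prod_expR_ffun (g : 'I_p -> R) x :
  \prod_k expR (g k) ^+ x k = expR (\sum_k (x k)%:R * g k).
Proof. by rewrite expR_sum; apply: eq_bigr => k _; rewrite expRM_natl. Qed.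

(** The Chernoff bound with l = ln (1 + t / V), the minimiser of
V (expR l - 1 - l) - l t, whose minimum is - V h (t / V).  The sign sg treats
both tails at once, as expR_sub_affine_le only sees the centred indicator
through its square.  V is an upper bound of the variance because for an
alternative only such a bound is available. *)
Lemma bennett_one_sided q j (sg V t : R) (A : pred {ffun 'I_p -> 'I_n.+1}) :
  (forall x, A x -> n%:R * t <= sg * ((x j)%:R - n%:R * q 0 j)) ->
  simplex q -> `|sg| = 1 ->
  0 < V -> q 0 j * (1 - q 0 j) <= V -> 0 <= t ->
  prob q A <= expR (- (n%:R * (V * h (t / V)))).
Proof.
move=> HA [q01 q1] sg1 V0 qV t0.
have q0 k : 0 <= q 0 k by have /andP[] := q01 k.
have tV : 0 <= t / V by rewrite divr_ge0// ltW.
pose l := ln (1 + t / V).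
have l0 : 0 <= l by rewrite ln_ge0; lra.
have el : expR l = 1 + t / V by rewrite lnK// posrE; lra.
pose g k : R := sg * l * ((k == j)%:R - q 0 j) - l * t.
apply: (le_trans (multinomial_markov _ _ q (fun k => expR (g k)) _ q0 (fun=> expR_ge0 _) _)).
  move=> x /HA Ax xn; rewrite prod_expR_ffun -[leLHS]expR0 ler_expR.
  have -> : \sum_k (x k)%:R * g k = l * (sg * ((x j)%:R - n%:R * q 0 j) - n%:R * t).
    have -> : n%:R = \sum_k (x k)%:R :> R by rewrite -natr_sum xn.
    have -> : (x j)%:R = \sum_k (x k)%:R * (k == j)%:R :> R.
      rewrite (bigD1 j)//= eqxx mulr1 big1 ?addr0// => k /negbTE ->; exact: mulr0.
    rewrite [(\sum_k (x k)%:R) * q 0 j]mulr_suml -sumrB mulr_sumr.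
    rewrite mulr_suml -sumrB mulr_sumr; apply: eq_bigr => k _.
    by rewrite /g; ring.
  by rewrite mulr_ge0// subr_ge0.
have Hq : 0 <= q 0 j <= 1 := q01 j.
have E k : q 0 k * expR (g k) <= expR (- (l * t)) *
    (q 0 k * (1 + sg * l * ((k == j)%:R - q 0 j) +
       ((k == j)%:R - q 0 j) ^+ 2 * (t / V - l))).
  rewrite mulrCA ler_wpM2l// /g expRD mulrC ler_wpM2l ?expR_ge0//.
  have dy : `|(k == j)%:R - q 0 j| <= 1.
    by rewrite ler_norml; case: (k == j) => /=; lra.
  have := @expR_sub_affine_le (sg * ((k == j)%:R - q 0 j)) l.
  rewrite normrM sg1 mul1r el exprMn -(real_normK (num_real sg)) sg1 expr1n mul1r.
  move=> /(_ dy l0); rewrite mulrA [l * sg]mulrC; lra.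
set K := expR (- (l * t)) in E.
have S1 : \sum_k q 0 k * expR (g k) <= K * (1 + V * (t / V - l)).
  apply: (le_trans (ler_sum _ (fun k _ => E k))).
  rewrite -mulr_sumr ler_wpM2l ?expR_ge0//.
  have -> : \sum_k q 0 k * (1 + sg * l * ((k == j)%:R - q 0 j) +
       ((k == j)%:R - q 0 j) ^+ 2 * (t / V - l)) =
      1 + q 0 j * (1 - q 0 j) * (t / V - l).
    transitivity (\sum_k (q 0 k * (1 - sg * l * q 0 j + q 0 j ^+ 2 * (t / V - l)) +
       q 0 k * (k == j)%:R * (sg * l + (1 - 2 * q 0 j) * (t / V - l)))).
      by apply: eq_bigr => k _; case: (k == j) => /=; ring.
    rewrite big_split/= -!mulr_suml q1.
    have -> : \sum_k q 0 k * (k == j)%:R = q 0 j.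
      rewrite (bigD1 j)//= eqxx mulr1 big1 ?addr0// => k /negbTE ->; exact: mulr0.
    ring.
  rewrite lerD2l ler_wpM2r// subr_ge0 [t / V](_ : _ = 1 + t / V - 1) ?ln_le_sub1//; lra.
have {}S1 : \sum_k q 0 k * expR (g k) <= expR (- (V * h (t / V))).
  apply: le_trans S1 _.
  have -> : - (V * h (t / V)) = - (l * t) + V * (t / V - l).
    rewrite hE; last by lra.
    by rewrite -/l; field; rewrite gt_eqF.
  by rewrite expRD ler_wpM2l ?expR_ge0// expR_ge1Dx.
apply: (le_trans (lerXn2r _ _ _ S1)).
- by rewrite nnegrE; apply: sumr_ge0 => k _; rewrite mulr_ge0 ?expR_ge0.
- by rewrite nnegrE expR_ge0.
by rewrite -expRM_natl mulrN.
Qed.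

Lemma bennett_two_sided q j (V t : R) (A : pred {ffun 'I_p -> 'I_n.+1}) :
  (forall x, A x -> n%:R * t <= `|(x j)%:R - n%:R * q 0 j|) ->
  simplex q -> 0 < V -> q 0 j * (1 - q 0 j) <= V -> 0 <= t ->
  prob q A <= 2 * expR (- (n%:R * (V * h (t / V)))).
Proof.
move=> HA sq V0 qV t0.
have q0 k : 0 <= q 0 k by case: sq => /(_ k)/andP[].
pose B (sg : R) := [pred x : {ffun 'I_p -> 'I_n.+1} |
  n%:R * t <= sg * ((x j)%:R - n%:R * q 0 j)].
have BB sg : `|sg| = 1 -> prob q (B sg) <= expR (- (n%:R * (V * h (t / V)))).
  by move=> sg1; apply: (@bennett_one_sided _ j sg).
apply: (@le_trans _ _ (prob q (B 1) + prob q (B (-1)))); last first.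
  by rewrite mulr2n mulrDl mul1r lerD// BB ?normrN ?normr1.
apply: (le_trans (multinomial_prob_le _ _ q A [pred x | B 1 x || B (-1) x] q0 _)).
  move=> x /HA; rewrite inE/= mul1r mulN1r.
  by case: (ger0P ((x j)%:R - n%:R * q 0 j)) => _ ->; rewrite ?orbT.
rewrite /multinomial_prob big_mkcond [X in _ <= X + _]big_mkcond
  [X in _ <= _ + X]big_mkcond -big_split/=.
apply: ler_sum => x _.
have := @multinomial_pmf_ge0 R n p q x q0.
by case: (_ <= 1 * _); case: (_ <= -1 * _) => /=; lra.
Qed.

Lemma bernstein_le_bennett (V t : R) : 0 < V -> 0 <= t ->
  t ^+ 2 / (2 * (2 * V + t)) <= V * h (t / V).
Proof.
move=> V0 t0; rewrite -ler_pdivrMl//.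
apply: le_trans (h_ge _ _); last by rewrite divr_ge0// ltW.
rewrite le_eqVlt; apply/orP; left; apply/eqP; field.
by rewrite !gt_eqF//; lra.
Qed.

End Tail.
End Bennett.

(** * The minimax risk, and the risk of the maximum test *)

Section Risk.
Context {R : realType}.
Variables n p : nat.
Local Notation prob := (@multinomial_prob R n p).
Local Notation sample := {ffun 'I_p -> 'I_n.+1}.
Implicit Types (q : 'rV[R]_p) (A : pred sample) (phi : sample -> bool).

Lemma simplex_ge0 q : simplex q -> forall k, 0 <= q 0 k.
Proof. by case=> q01 _ k; have /andP[] := q01 k. Qed.

Lemma multinomial_prob_compl q A : simplex q ->
  prob q A + prob q [pred x | ~~ A x] = 1.
Proof.
by case=> _ q1; rewrite -(multinomial_sum1 n p q q1) [RHS](bigID A).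
Qed.

Lemma multinomial_prob_exists q (A : 'I_p -> pred sample) : simplex q ->
  prob q [pred x | [exists j, A j x]] <= \sum_j prob q (A j).
Proof.
move=> /simplex_ge0 q0.
under eq_bigr do rewrite /multinomial_prob big_mkcond.
rewrite exchange_big/= /multinomial_prob big_mkcond/=.
have F x : 0 <= multinomial_pmf q x by exact: multinomial_pmf_ge0.
apply: ler_sum => x _.
case: ifP => [/existsP[j Aj]|_].
  by rewrite (bigD1 j)//= Aj lerDl sumr_ge0// => k _; case: ifP.
by apply: sumr_ge0 => k _; case: ifP.
Qed.

Lemma type2_error_has_ubound q0 (eps : R) phi :
  has_ubound [set prob q [pred x | ~~ phi x] | q in alternatives q0 eps].
Proof. by exists 1 => _ [q [sq _] <-]; exact: multinomial_prob_le1. Qed.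

(** The case distinction covers an empty set of alternatives, where sup is 0. *)
Lemma type2_error_le q0 (eps b : R) phi : 0 <= b ->
  (forall q, alternatives q0 eps q -> prob q [pred x | ~~ phi x] <= b) ->
  sup [set prob q [pred x | ~~ phi x] | q in alternatives q0 eps] <= b.
Proof.
move=> b0 H.
have [->|/set0P ne] :=
  eqVneq [set prob q [pred x | ~~ phi x] | q in alternatives q0 eps] set0.
  by rewrite sup0.
by apply: ge_sup => // _ [q /H Hq <-].
Qed.

Lemma type2_error_ge q0 (eps : R) phi q : alternatives q0 eps q ->
  prob q [pred x | ~~ phi x] <=
  sup [set prob q [pred x | ~~ phi x] | q in alternatives q0 eps].
Proof.
move=> aq; apply: ub_le_sup; first exact: type2_error_has_ubound.
by exists q.
Qed.

Lemma test_risk_ge0 q0 (eps : R) phi : simplex q0 -> 0 <= test_risk q0 eps phi.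
Proof.
move=> sq; rewrite addr_ge0//; first by apply: multinomial_prob_ge0; exact: simplex_ge0.
have [->|/set0P[_ [q aq _]]] :=
  eqVneq [set prob q [pred x | ~~ phi x] | q in alternatives q0 eps] set0.
  by rewrite sup0.
apply: le_trans (type2_error_ge _ _ phi _ aq).
by apply: multinomial_prob_ge0; apply: simplex_ge0; case: aq.
Qed.

Lemma minimax_risk_ge q0 (eps b : R) :
  (forall phi, b <= @test_risk R n p q0 eps phi) -> b <= minimax_risk eps n q0.
Proof.
move=> H; apply: lb_le_inf; first by exists (@test_risk R n p q0 eps xpredT), xpredT.
by move=> _ [phi _ <-].
Qed.

Lemma minimax_risk_le q0 (eps : R) phi : simplex q0 ->
  minimax_risk eps n q0 <= test_risk q0 eps phi.
Proof.
move=> sq; apply: ge_inf; last by exists phi.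
by exists 0 => _ [psi _ <-]; exact: test_risk_ge0.
Qed.

Lemma minimax_risk_le1 q0 (eps : R) : simplex q0 -> minimax_risk eps n q0 <= 1.
Proof.
move=> sq; apply: le_trans (minimax_risk_le q0 eps xpredT sq) _.
rewrite -[leRHS]addr0 lerD ?multinomial_prob_le1// type2_error_le// => q _.
by rewrite /multinomial_prob big_pred0.
Qed.

(** The exponent in Bernstein's inequality for a deviation d when the variance
is V + d: moving a coordinate by d changes its variance by at most d. *)
Definition bernstein_exponent (V d : R) := n%:R * d ^+ 2 / (2 * (2 * V + 3 * d)).

(** Used for the largest coordinate under the null, for the moved coordinate under
an alternative, and for the truncation of the likelihood ratios. *)
Lemma deviation_prob_le q j (c V0 d t : R) A :
  (forall x, A x -> n%:R * t <= `|(x j)%:R - n%:R * q 0 j|) ->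
  simplex q -> 0 < V0 -> q 0 j * (1 - q 0 j) <= V0 + d ->
  0 < c <= 1 -> 0 < d -> c * d <= t ->
  prob q A <= 2 * expR (- (c ^+ 2 * bernstein_exponent V0 d)).
Proof.
move=> HA sq V00 qV /andP[c0 c1] d0 cdt.
have cd0 : 0 <= c * d by rewrite mulr_ge0// ltW.
have V1 : 0 < V0 + d by lra.
apply: (le_trans (bennett_two_sided n p q j (V0 + d) (c * d) A _ sq _ qV _)) => //.
  by move=> x /HA; apply: le_trans; rewrite ler_wpM2l.
rewrite ler_pM2l// ler_expR lerN2.
rewrite /bernstein_exponent -[X in _ * X]mulrA mulrCA. apply: ler_wpM2l => //.
apply: le_trans (bernstein_le_bennett _ _ V1 cd0).
rewrite [in leRHS]exprMn -[leRHS]mulrA; apply: ler_wpM2l; first exact: sqr_ge0.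
apply: ler_wpM2l; first exact: sqr_ge0.
rewrite lef_pV2 ?posrE; [|lra..].
have : c * d <= d by rewrite ger_pMl.
lra.
Qed.

(** The test rejects when some coordinate deviates by s * eps from q0.  A union
bound controls the first kind of error, with a separate weight w j for each
coordinate other than j0.  If q moves coordinate j by d >= eps, then to accept
X_j must deviate from its mean by d - s * eps >= (1 - s) * d. *)
Lemma minimax_risk_upper q0 (j0 : 'I_p) (eps V0 s : R) (w : 'I_p -> R) :
  simplex q0 -> 0 < eps -> 0 < V0 -> (forall j, q0 0 j * (1 - q0 0 j) <= V0) ->
  0 < s < 1 ->
  (forall j, j != j0 -> let v := q0 0 j * (1 - q0 0 j) in
     0 < v /\ w j <= n%:R * (v * h (s * eps / v))) ->
  minimax_risk eps n q0 <= \sum_(j | j != j0) 2 * expR (- w j) +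
     2 * expR (- (s ^+ 2 * bernstein_exponent V0 eps)) +
     2 * expR (- ((1 - s) ^+ 2 * bernstein_exponent V0 eps)).
Proof.
move=> sq e0 V00 qV0 /andP[s0 s1] Hw.
have se0 : 0 < s * eps by rewrite mulr_gt0.
pose A j := [pred x : sample | n%:R * (s * eps) <= `|(x j)%:R - n%:R * q0 0 j|].
apply: le_trans (minimax_risk_le q0 eps (fun x => [exists j, A j x]) sq) _.
apply: lerD.
  apply: (le_trans (multinomial_prob_exists q0 A sq)).
  rewrite (bigD1 j0)//= addrC; apply: lerD.
    apply: ler_sum => j /Hw [v0 Hj].
    apply: (le_trans (bennett_two_sided n p q0 j _ (s * eps) (A j) _ sq v0 _ (ltW se0))) => //.
    by rewrite ler_pM2l// ler_expR lerN2.
  apply: (deviation_prob_le q0 j0 s V0 eps (s * eps) (A j0)) => //; last by rewrite s0 ltW.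
  by apply: le_trans (qV0 j0) _; lra.
apply: type2_error_le; first by rewrite mulr_ge0// expR_ge0.
move=> q [sq' eq].
have [j Hj] : exists j, `|q - q0| = `|q 0 j - q0 0 j|.
  have : mx_norm (q - q0) != 0.
    have : 0 < `|q - q0| by apply: lt_le_trans eq.
    by move=> /lt0r_neq0.
  by move=> /mx_norm_neq0[[i j]] /= E; exists j; rewrite [LHS]E !mxE (ord1 i).
rewrite Hj in eq; set d := `|q 0 j - q0 0 j| in eq.
have qj : 0 <= q 0 j <= 1 := proj1 sq' j.
have q0j : 0 <= q0 0 j <= 1 := proj1 sq j.
apply: (@le_trans _ _ (2 * expR (- ((1 - s) ^+ 2 * bernstein_exponent V0 d)))).
  apply: (deviation_prob_le q j (1 - s) V0 d (d - s * eps)) => //.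
  - move=> x /=; rewrite negb_exists => /forallP/(_ j) /=; rewrite -ltNge => Hx.
    have : n%:R * d = `|n%:R * (q 0 j - q0 0 j)| by rewrite normrM ger0_norm.
    have : `|n%:R * (q 0 j - q0 0 j)| <=
        `|(x j)%:R - n%:R * q0 0 j| + `|(x j)%:R - n%:R * q 0 j|.
      rewrite [leRHS]addrC -[X in _ <= X + _]normrN -[X in _ <= _ + X]normrN.
      rewrite -[X in _ <= _ + X]normrN opprK.
      apply: le_trans (ler_normD _ _).
      by rewrite le_eqVlt; apply/orP; left; apply/eqP; congr (`| _ |); ring.
    lra.
  - have : q 0 j * (1 - q 0 j) <= q0 0 j * (1 - q0 0 j) + d.
      have : q 0 j * (1 - q 0 j) - q0 0 j * (1 - q0 0 j) =
          (q 0 j - q0 0 j) * (1 - q 0 j - q0 0 j) by ring.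
      have : (q 0 j - q0 0 j) * (1 - q 0 j - q0 0 j) <= d.
        apply: le_trans (ler_norm _) _; rewrite normrM ler_piMr//.
        by rewrite ler_norml; lra.
      lra.
    by have := qV0 j; lra.
  - lra.
  - lra.
  - have : s * eps <= s * d by rewrite ler_pM2l.
    lra.
rewrite ler_pM2l// ler_expR lerN2 ler_wpM2l ?sqr_ge0//.
rewrite /bernstein_exponent -![n%:R * _ / _]mulrA; apply: ler_wpM2l => //.
rewrite ler_pdivlMr; last lra.
rewrite mulrAC ler_pdivrMr; last lra.
have H1 : 0 <= V0 * (d - eps) * (d + eps) by rewrite !mulr_ge0//; lra.
have H2 : 0 <= eps * d * (d - eps) by rewrite !mulr_ge0//; lra.
nra.
Qed.
End Risk.

(** * The truncated second moment method *)

Section SecondMoment.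
Context {R : realType}.
Variables (T I : finType) (w : T -> R) (J : {set I}) (L Lt : I -> T -> R).
Hypothesis w_ge0 : forall x, 0 <= w x.
Hypothesis w_sum1 : \sum_x w x = 1.
Hypothesis J_gt0 : (0 < #|J|)%N.

(** Expand the square.  The M (M - 1) cross terms contribute at most 1 and cancel
against 1 - 2, up to beta; the M diagonal ones contribute at most B / M. *)
Lemma truncated_second_moment (beta B : R) :
  (forall i, i \in J -> 1 - beta <= \sum_x w x * Lt i x) ->
  (forall i, i \in J -> \sum_x w x * Lt i x ^+ 2 <= B) ->
  (forall i j, i \in J -> j \in J -> i != j ->
     \sum_x w x * (Lt i x * Lt j x) <= 1) ->
  \sum_x w x * (1 - #|J|%:R^-1 * \sum_(i in J) Lt i x) ^+ 2
    <= 2 * beta + B / #|J|%:R.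
Proof.
move=> E1 E2 E12; set M : R := #|J|%:R.
have M0 : 0 < M by rewrite ltr0n.
have S1 : M * (1 - beta) <= \sum_(i in J) \sum_x w x * Lt i x.
  rewrite /M mulr_natl -sumr_const; exact: ler_sum.
have S2 : \sum_(i in J) \sum_(j in J) \sum_x w x * (Lt i x * Lt j x) <= M * (B + M).
  rewrite /M mulr_natl -sumr_const; apply: ler_sum => i iJ.
  rewrite (bigD1 i)//=; apply: lerD.
    by under eq_bigr do rewrite -expr2; exact: E2.
  apply: (@le_trans _ _ (\sum_(j in J | j != i) 1)).
    by apply: ler_sum => j /andP[jJ ji]; rewrite E12// eq_sym.
  rewrite -sumr_const [leRHS](bigD1 i)//=; lra.
have -> : \sum_x w x * (1 - M^-1 * \sum_(i in J) Lt i x) ^+ 2 =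
    1 - 2 * (M^-1 * \sum_(i in J) \sum_x w x * Lt i x) +
    M ^- 2 * \sum_(i in J) \sum_(j in J) \sum_x w x * (Lt i x * Lt j x).
  rewrite exchange_big/= -[X in _ = X - _ + _]w_sum1.
  under [X in _ = _ + _ * X]eq_bigr do rewrite exchange_big/=.
  rewrite [X in _ = _ + _ * X]exchange_big/=.
  rewrite !mulr_sumr -sumrB -big_split/=; apply: eq_bigr => x _.
  rewrite -mulr_sumr.
  have -> : \sum_(i in J) \sum_(j in J) w x * (Lt i x * Lt j x) =
     w x * (\sum_(i in J) Lt i x) ^+ 2.
    rewrite expr2 mulr_suml mulr_sumr; apply: eq_bigr => i _.
    by rewrite mulr_sumr mulr_sumr.
  by field; rewrite gt_eqF.
have {}S1 : 1 - beta <= M^-1 * \sum_(i in J) \sum_x w x * Lt i x.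
  by rewrite ler_pdivlMl.
have {}S2 : M ^- 2 * \sum_(i in J) \sum_(j in J) \sum_x w x * (Lt i x * Lt j x) <= B / M + 1.
  rewrite ler_pdivrMl ?exprn_gt0//; apply: le_trans S2 _.
  rewrite le_eqVlt; apply/orP; left; apply/eqP; field.
  by rewrite gt_eqF.
lra.
Qed.

(** The worst of the alternatives is at least as hard as their average, and
dropping mass from the average helps the test.  If l is the truncated average
likelihood ratio, the risk is at least the mean of min (1, l) >= 1 - |1 - l|,
and |1 - l| <= c / 2 + (1 - l)^2 / (2 c). *)
Lemma mixture_risk_ge (c : R) (rho : R) (phi : T -> bool) :
  (forall i, i \in J -> forall x, Lt i x <= L i x) -> 0 < c ->
  (forall i, i \in J ->
     \sum_(x | phi x) w x + \sum_(x | ~~ phi x) w x * L i x <= rho) ->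
  1 - c / 2 - (\sum_x w x * (1 - #|J|%:R^-1 * \sum_(i in J) Lt i x) ^+ 2) / (2 * c) <= rho.
Proof.
move=> LtL c0 Hrho; set M : R := #|J|%:R.
have M0 : 0 < M by rewrite ltr0n.
set Lb := fun x => M^-1 * \sum_(i in J) Lt i x.
apply: (@le_trans _ _ (\sum_(x | phi x) w x + \sum_(x | ~~ phi x) w x * Lb x)); last first.
  rewrite -(ler_pM2l M0) mulrDr.
  have -> : M * (\sum_(x | ~~ phi x) w x * Lb x) =
      \sum_(i in J) \sum_(x | ~~ phi x) w x * Lt i x.
    rewrite exchange_big/= mulr_sumr; apply: eq_bigr => x _.
    by rewrite -mulr_sumr mulrCA /Lb mulVKf ?gt_eqF.
  rewrite /M !mulr_natl -!sumr_const -big_split/=.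
  apply: ler_sum => i iJ; apply: le_trans (Hrho i iJ).
  by rewrite lerD2l; apply: ler_sum => x _; rewrite ler_wpM2l// LtL.
rewrite -{1}w_sum1 [X in X / 2](_ : c = \sum_x w x * c);
  last by rewrite -mulr_suml w_sum1 mul1r.
rewrite !mulr_suml -!sumrB [X in _ <= X + _]big_mkcond
  [X in _ <= _ + X]big_mkcond -big_split/=.
apply: ler_sum => x _; rewrite -/(Lb x).
set l := Lb x.
have A1 : 0 <= (1 - l) ^+ 2 / (2 * c) by rewrite divr_ge0 ?sqr_ge0//; lra.
have A2 : 1 - l <= c / 2 + (1 - l) ^+ 2 / (2 * c).
  have : 0 <= (1 - l - c) ^+ 2 / (2 * c) by rewrite divr_ge0 ?sqr_ge0//; lra.
  have -> : (1 - l - c) ^+ 2 / (2 * c) = (1 - l) ^+ 2 / (2 * c) - (1 - l) + c / 2.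
    by field; rewrite gt_eqF.
  lra.
have -> : w x - w x * c / 2 - w x * (1 - l) ^+ 2 / (2 * c) =
   w x * (1 - c / 2 - (1 - l) ^+ 2 / (2 * c)) by field; rewrite gt_eqF.
case: (phi x) => /=; rewrite ?addr0 ?add0r.
  by rewrite ler_piMr//; lra.
by rewrite ler_wpM2l//; lra.
Qed.
End SecondMoment.

(** * Lower bound from a mixture of spikes *)

Section Lower.
Context {R : realType}.
Variables n p : nat.
Local Notation prob := (@multinomial_prob R n p).
Local Notation pmf := (@multinomial_pmf R n p).
Local Notation sample := {ffun 'I_p -> 'I_n.+1}.
Implicit Types (q : 'rV[R]_p) (i j k : 'I_p) (e : R).

(** The mass added to coordinate i is taken from the others in proportion.  Given
X_i, the remaining counts then have the same law as under q, so they carry no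
information, and no coordinate but the i-th reveals the spike. *)
Definition spike_ratio q e i k : R :=
  if k == i then 1 + e / q 0 i else 1 - e / (1 - q 0 i).
Definition spike q e i : 'rV[R]_p := \row_k (q 0 k * spike_ratio q e i k).
Definition spike_lr q e i (x : sample) : R := \prod_k spike_ratio q e i k ^+ x k.

Variables (q : 'rV[R]_p) (e : R).
Hypothesis sq : simplex q.
Hypothesis e_gt0 : 0 < e.

Definition spikable i := 0 < q 0 i /\ q 0 i + e <= 1.

Lemma spike_ratio_ge0 i k : spikable i -> 0 <= spike_ratio q e i k.
Proof.
move=> [qi0 qe]; have e0 := e_gt0; rewrite /spike_ratio; case: eqP => _.
  by rewrite addr_ge0// divr_ge0// ltW.
by rewrite subr_ge0 ler_pdivrMr; lra.
Qed.

Lemma spike_simplex i : spikable i -> simplex (spike q e i).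
Proof.
move=> si; have e0 := e_gt0; have [qi0 qe] := si.
have s0 k : 0 <= spike q e i 0 k.
  by rewrite mxE mulr_ge0 ?spike_ratio_ge0// simplex_ge0.
have s1 : \sum_k spike q e i 0 k = 1.
  rewrite (bigD1 i)//= mxE {1}/spike_ratio eqxx.
  have -> : \sum_(k | k != i) spike q e i 0 k =
      \sum_(k | k != i) q 0 k * (1 - e / (1 - q 0 i)).
    by apply: eq_bigr => k ki; rewrite mxE /spike_ratio (negbTE ki).
  rewrite -mulr_suml.
  have -> : \sum_(k | k != i) q 0 k = 1 - q 0 i.
    by have [_] := sq; rewrite (bigD1 i)//= => q1; lra.
  by field; rewrite !gt_eqF//; lra.
split=> // k; rewrite s0/= -s1 (bigD1 k)//= lerDl sumr_ge0//.
Qed.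

Lemma spike_alternative i : spikable i -> alternatives q e (spike q e i).
Proof.
move=> si; split; first exact: spike_simplex.
have e0 := e_gt0; have [qi0 qe] := si.
apply: (@le_trans _ _ `|(spike q e i - q) 0 i|); last first.
  rewrite [leRHS]mx_normrE.
  exact: (le_bigmax _ (fun ij : 'I_1 * 'I_p => `|(spike q e i - q) ij.1 ij.2|) (0, i)).
rewrite !mxE /spike_ratio eqxx mulrDr mulr1 mulrC divfK ?gt_eqF//.
by rewrite addrC addKr ger0_norm// ltW.
Qed.

Lemma spike_pmf i x : pmf (spike q e i) x = pmf q x * spike_lr q e i x.
Proof. exact: multinomial_pmf_mul. Qed.

Lemma spike_lr_ge0 i x : spikable i -> 0 <= spike_lr q e i x.
Proof. by move=> si; apply: prodr_ge0 => k _; rewrite exprn_ge0// spike_ratio_ge0. Qed.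

(** For n = 1 the ratios minus 1 are multiples of centred indicators of two
different categories, which are negatively correlated: the expectation is
1 - a i * a j. *)
Lemma spike_lr_cross i j : spikable i -> spikable j -> i != j ->
  \sum_x pmf q x * (spike_lr q e i x * spike_lr q e j x) <= 1.
Proof.
move=> si sj ij; have [qi0 qi] := si; have [qj0 qj] := sj; have e0 := e_gt0.
have -> : \sum_x pmf q x * (spike_lr q e i x * spike_lr q e j x) =
  \sum_x pmf q x * \prod_k (spike_ratio q e i k * spike_ratio q e j k) ^+ x k.
  apply: eq_bigr => x _; congr (_ * _); rewrite -big_split/=.
  by apply: eq_bigr => k _; rewrite exprMn.
rewrite multinomial_mgf.
have S0 : 0 <= \sum_k q 0 k * (spike_ratio q e i k * spike_ratio q e j k).
  by apply: sumr_ge0 => k _; rewrite !mulr_ge0 ?spike_ratio_ge0 ?simplex_ge0.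
apply: exprn_ile1 => //.
pose a m := e / (1 - q 0 m).
have E k : q 0 k * (spike_ratio q e i k * spike_ratio q e j k) =
   q 0 k * ((1 - a i) * (1 - a j)) +
   (q 0 k * (k == i)%:R * ((e / q 0 i + a i) * (1 - a j)) +
    q 0 k * (k == j)%:R * ((e / q 0 j + a j) * (1 - a i))).
  rewrite /spike_ratio -/(a i) -/(a j).
  case: (eqVneq k i) => [->|ki] /=; first by rewrite (negbTE ij) /=; ring.
  by case: (eqVneq k j) => [->|kj] /=; ring.
have D m : \sum_k q 0 k * (k == m)%:R = q 0 m.
  by rewrite (bigD1 m)//= eqxx mulr1 big1 ?addr0// => k /negbTE ->; exact: mulr0.
rewrite (eq_bigr _ (fun k _ => E k)) !big_split/= -!mulr_suml !D.
have [_ ->] := sq.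
have ai0 : 0 <= a i by rewrite /a divr_ge0//; lra.
have aj0 : 0 <= a j by rewrite /a divr_ge0//; lra.
have -> : q 0 i * ((e / q 0 i + a i) * (1 - a j)) = a i * (1 - a j).
  by rewrite /a; field; rewrite !gt_eqF//; lra.
have -> : q 0 j * ((e / q 0 j + a j) * (1 - a i)) = a j * (1 - a i).
  by rewrite /a; field; rewrite !gt_eqF//; lra.
have := mulr_ge0 ai0 aj0; lra.
Qed.

Lemma spike_lrE i (x : sample) : (\sum_k x k = n)%N ->
  spike_lr q e i x = (1 + e / q 0 i) ^+ x i * (1 - e / (1 - q 0 i)) ^+ (n - x i).
Proof.
move=> xn; rewrite /spike_lr (bigD1 i)//= {1}/spike_ratio eqxx; congr (_ * _).
have -> : (n - x i = \sum_(k | k != i) x k)%N.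
  by rewrite -[X in (X - _)%N]xn (bigD1 i)//= addKn.
rewrite -prodrXr; apply: eq_bigr => k ki.
by rewrite /spike_ratio (negbTE ki).
Qed.

(** B bounds the likelihood ratio on the truncation event.  The truncated second
moment is at most B because the remaining factor integrates to 1. *)
Lemma minimax_risk_lower (J : {set 'I_p}) (V0 eta B c : R) :
  (0 < #|J|)%N -> 0 < V0 -> 0 < eta <= 1 -> 0 < c ->
  (forall i, i \in J -> spikable i /\ q 0 i * (1 - q 0 i) <= V0) ->
  (forall i, i \in J -> forall m, (m <= n)%N -> m%:R <= n%:R * (q 0 i + (1 + eta) * e) ->
     (1 + e / q 0 i) ^+ m * (1 - e / (1 - q 0 i)) ^+ (n - m) <= B) ->
  1 - c / 2 -
   (2 * (2 * expR (- (eta ^+ 2 * bernstein_exponent n V0 e))) + B / #|J|%:R) / (2 * c)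
  <= minimax_risk e n q.
Proof.
have e0 := e_gt0; move=> J0 V00 eta01 c0 HJ HB; apply: minimax_risk_ge => phi.
pose D i (x : sample) := (x i)%:R <= n%:R * (q 0 i + (1 + eta) * e).
pose L := spike_lr q e.
pose Lt i x := if D i x then L i x else 0.
set beta := 2 * expR _.
have w0 x : 0 <= pmf q x by apply: multinomial_pmf_ge0; exact: simplex_ge0.
have w1 : \sum_x pmf q x = 1 by apply: multinomial_sum1; case: sq.
have LtL i : i \in J -> forall x, 0 <= Lt i x <= L i x.
  by move=> /HJ[si _] x; rewrite /Lt; case: ifP => _; rewrite lexx ?spike_lr_ge0.
have le_L i : i \in J -> forall x, Lt i x <= L i x.
  by move=> /LtL H x; have /andP[] := H x.
have le_risk i : i \in J ->
    \sum_(x | phi x) pmf q x + \sum_(x | ~~ phi x) pmf q x * L i x <= test_risk q e phi.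
  move=> /HJ[/spike_alternative si _]; rewrite /test_risk lerD2l.
  apply: le_trans (type2_error_ge n p _ _ phi _ si).
  by rewrite le_eqVlt; apply/orP; left; apply/eqP; apply: eq_bigr => x _; rewrite spike_pmf.
apply: le_trans (mixture_risk_ge _ _ (pmf q) J L Lt w0 w1 J0 c _ phi le_L c0 le_risk).
rewrite lerD2l lerN2; apply: ler_wpM2r; first by rewrite invr_ge0; lra.
apply: truncated_second_moment => //.
- move=> i /[dup] /LtL LtLi /HJ[si qV].
  have -> : \sum_x pmf q x * Lt i x = prob (spike q e i) (D i).
    rewrite /multinomial_prob [RHS]big_mkcond/=; apply: eq_bigr => x _.
    by rewrite /Lt spike_pmf -/(L i x); case: ifP => _ //; rewrite mulr0.
  have := multinomial_prob_compl n p (spike q e i) (D i) (spike_simplex i si).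
  suff : prob (spike q e i) [pred x | ~~ D i x] <= beta by lra.
  have qi : spike q e i 0 i = q 0 i + e.
    rewrite mxE /spike_ratio eqxx mulrDr mulr1 mulrC; rewrite [in LHS]divfK ?gt_eqF//.
    by case: si.
  have [si0 si1] := si.
  apply: (deviation_prob_le n p _ i eta V0 e (eta * e)) => //.
  - move=> x /=; rewrite -ltNge qi => Hx; apply: le_trans (ler_norm _); lra.
  - exact: spike_simplex.
  - rewrite qi; nra.
- move=> i /[dup] iJ /HJ[si qV].
  have -> : B = \sum_x pmf q x * spike_lr q e i x * B.
    rewrite -mulr_suml -[LHS]mul1r; congr (_ * _).
    have [_ s1] := spike_simplex i si; rewrite -(multinomial_sum1 n p _ s1).
    by apply: eq_bigr => x _; rewrite spike_pmf.
  have B0 : 0 <= B.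
    have [qi0 qi1] := si.
    apply: le_trans (HB i iJ 0%N _ _) => //.
      rewrite mulr_ge0 ?exprn_ge0//; last by rewrite subr_ge0 ler_pdivrMr; lra.
      by rewrite addr_ge0// divr_ge0// ltW.
    by rewrite mulr_ge0// addr_ge0 ?mulr_ge0//; lra.
  apply: ler_sum => x _; rewrite -mulrA.
  have [xn|/multinomial_pmf_supp->] := eqVneq (\sum_k x k)%N n; last by rewrite !mul0r.
  apply: ler_wpM2l => //.
  rewrite /Lt; case: ifP => Dx; last first.
    by rewrite expr0n mulr_ge0// spike_lr_ge0.
  rewrite expr2; apply: ler_wpM2l; first exact: spike_lr_ge0.
  by rewrite /L spike_lrE//; apply: HB => //; rewrite -ltnS.
- move=> i j /[dup] /LtL Li /HJ[si _] /[dup] /LtL Lj /HJ[sj _] ij.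
  apply: le_trans (spike_lr_cross i j si sj ij); apply: ler_sum => x _.
  apply: ler_wpM2l => //; have /andP[? ?] := Li x; have /andP[? ?] := Lj x.
  exact: ler_pM.
Qed.

End Lower.

(** * Thresholds, their weights, and truncated likelihood ratios *)

Section HScale.
Context {R : realType}.
Implicit Types u v x y c : R.

Lemma hinv_le x y : 0 <= x -> 0 <= y -> y <= h x -> hinv y <= x.
Proof.
move=> x0 y0 yx; have [hi0 hiK] := hinvP y y0.
by rewrite leNgt; apply/negP => /(h_lt _ _ x0); rewrite hiK ltNge yx.
Qed.

(** The Bennett exponent decreases with the variance: the same deviation is more
likely for a larger variance. *)
Lemma h_perspective_le u v x : 0 < u -> u <= v -> 0 <= x ->
  v * h (x / v) <= u * h (x / u).
Proof.
move=> u0 uv x0; have v0 : 0 < v by lra.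
have := h_scale_le (u / v) (x / u).
rewrite divr_ge0 ?ler_pdivrMr ?mul1r; [|lra..].
move=> /(_ uv); rewrite divr_ge0; [|lra..] => /(_ isT).
have -> : u / v * (x / u) = x / v by field; rewrite !gt_eqF.
rewrite -(ler_pM2l v0); congr (_ <= _).
by rewrite mulrA [v * _]mulrC divfK ?gt_eqF.
Qed.

Lemma nprime_ge n : n%:R <= nprime n :> R.
Proof. by rewrite /nprime ler_peMl// lerDl powR_ge0. Qed.

(** The threshold is the deviation whose Bennett exponent, with n' observations,
is y. *)
Lemma hscaleP n u y : (0 < n)%N -> 0 < u < 1 -> 0 <= y ->
  0 <= hscale n u y /\
  nprime n * (u * (1 - u) * h (hscale n u y / (u * (1 - u)))) = y.
Proof.
move=> n0 /andP[u0 u1] y0.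
have N0 : 0 < nprime n :> R by apply: lt_le_trans (nprime_ge n); rewrite ltr0n.
have v0 : 0 < u * (1 - u) by rewrite mulr_gt0//; lra.
have yN : 0 <= y / (nprime n * u * (1 - u)) by rewrite divr_ge0// -mulrA mulr_ge0 ?ltW.
have [hi0 hiK] := hinvP _ yN.
rewrite /hscale; split; first by rewrite mulr_ge0// ltW.
rewrite [X in h X](_ : _ = hinv (y / (nprime n * u * (1 - u)))).
  rewrite hiK; field.
  by rewrite !gt_eqF//; lra.
by rewrite mulrAC divff ?gt_eqF// mul1r.
Qed.

Lemma hscale_le n u y1 y2 : (0 < n)%N -> 0 < u < 1 -> 0 <= y1 -> y1 <= y2 ->
  hscale n u y1 <= hscale n u y2.
Proof.
move=> n0 /andP[u0 u1] y0 y12.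
have N0 : 0 < nprime n :> R by apply: lt_le_trans (nprime_ge n); rewrite ltr0n.
have v0 : 0 < u * (1 - u) by rewrite mulr_gt0//; lra.
have D0 : 0 <= (nprime n * u * (1 - u))^-1 by rewrite invr_ge0 -mulrA mulr_ge0 ?ltW.
rewrite /hscale ler_pM2l//.
have [h20 h2K] := hinvP (y2 / (nprime n * u * (1 - u))) (mulr_ge0 (le_trans y0 y12) D0).
by apply: hinv_le => //; rewrite ?h2K ?mulr_ge0// ler_wpM2r.
Qed.

Lemma hscale_mulr_le n u y c : (0 < n)%N -> 0 < u < 1 -> 0 <= y -> 1 <= c ->
  hscale n u (c * y) <= c * hscale n u y.
Proof.
move=> n0 /andP[u0 u1] y0 c1.
have N0 : 0 < nprime n :> R by apply: lt_le_trans (nprime_ge n); rewrite ltr0n.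
have v0 : 0 < u * (1 - u) by rewrite mulr_gt0//; lra.
have D0 : 0 <= (nprime n * u * (1 - u))^-1 by rewrite invr_ge0 -mulrA mulr_ge0 ?ltW.
have [h20 h2K] := hinvP (y / (nprime n * u * (1 - u))) (mulr_ge0 y0 D0).
rewrite /hscale mulrCA ler_pM2l//.
apply: hinv_le; [by rewrite mulr_ge0//; lra|by rewrite !mulr_ge0//; lra|].
have c0 : 0 < c by lra.
rewrite -mulrA -{1}h2K -ler_pdivlMl//.
have := h_scale_le c^-1 (c * hinv (y / (nprime n * u * (1 - u)))).
rewrite mulKf ?gt_eqF//; apply; last by rewrite mulr_ge0//; lra.
by rewrite invr_ge0 ltW//= invf_le1.
Qed.

(** The term of index j is at most the increment of - 1 / (1 + ln j), because
ln (j + 1) - ln j >= 1 / (j + 1).  So the sum telescopes. *)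
Lemma sum_inv_mul_sqr_ln m :
  \sum_(1 <= j < m) (j%:R * (1 + ln j%:R) ^+ 2)^-1 <= 2 :> R.
Proof.
case: m => [|[|m]]; [by rewrite big_geq|by rewrite big_geq|].
suff : \sum_(1 <= j < m.+2) (j%:R * (1 + ln j%:R) ^+ 2)^-1 <= 2 - (1 + ln m.+1%:R)^-1 :> R.
  move=> /le_trans; apply; rewrite gerBl invr_ge0 addr_ge0// ln_ge0// ler1n//.
elim: m => [|m IH].
  by rewrite big_nat1 ln1 addr0 expr1n mulr1; lra.
rewrite big_nat_recr//=; apply: (le_trans (lerD IH (lexx _))).
set a : R := 1 + ln m.+1%:R; set b : R := 1 + ln m.+2%:R.
have a1 : 1 <= a by rewrite lerDl ln_ge0// ler1n.
have M0 : 0 < m.+2%:R :> R by rewrite ltr0n.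
have ab : m.+2%:R^-1 <= b - a.
  have := ln_ge_1subV (m.+2%:R / m.+1%:R : R).
  rewrite divr_gt0// => /(_ isT); rewrite ln_div ?posrE ?ltr0n// invf_div.
  have -> : 1 - m.+1%:R / m.+2%:R = m.+2%:R^-1 :> R.
    by rewrite -[in LHS]natr1; field.
  by rewrite /a /b opprD addrACA subrr add0r.
have ab' : a <= b by rewrite -subr_ge0 (le_trans _ ab)// invr_ge0.
rewrite -lerBrDl.
have -> : 2 - b^-1 - (2 - a^-1) = (b - a) / (a * b) by field; rewrite !gt_eqF; lra.
rewrite invfM; apply: ler_pM => //; first by rewrite invr_ge0 sqr_ge0.
by rewrite lef_pV2 ?posrE ?mulr_gt0 ?exprn_gt0; [rewrite expr2 ler_pM2r; lra|lra..].
Qed.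

(** The likelihood ratio increases with m, so take m = n (q + (1 + eta) e).  Then
the logarithm is n q h (e / q) plus an error due to eta, which mul_ln1D_le
bounds relatively to h, and one due to the scaling of the other coordinates,
of order n e^2, which h_ge bounds relatively to h. *)
Lemma lr_truncated_le (n m : nat) (q e eta : R) : 0 < q <= 1 / 2 -> 0 < e ->
  q + e <= 1 -> 0 <= eta <= 1 -> (m <= n)%N ->
  m%:R <= n%:R * (q + (1 + eta) * e) ->
  (1 + e / q) ^+ m * (1 - e / (1 - q)) ^+ (n - m) <=
  expR (n%:R * (q * h (e / q)) * (1 + 4 * eta + 8 * (2 * q + e))).
Proof.
move=> /andP[q0 q1] e0 qe /andP[t0 t1] mn mM.
have x0 : 0 < e / q by rewrite divr_gt0.
pose l := ln (1 + e / q).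
have l0 : 0 <= l by rewrite ln_ge0; lra.
have -> : 1 + e / q = expR l by rewrite lnK// posrE; lra.
pose b := e / (1 - q).
have b0 : 0 <= b by rewrite divr_ge0//; lra.
have bE : b * (1 - q) = e by rewrite /b divfK// gt_eqF//; lra.
have b1 : b <= 2 * e by rewrite /b ler_pdivrMr; [nra|lra].
apply: (@le_trans _ _ (expR l ^+ m * expR (- b) ^+ (n - m))).
  rewrite ler_wpM2l ?exprn_ge0 ?expR_ge0// lerXn2r ?nnegrE ?expR_ge0//.
    by rewrite subr_ge0 ler_pdivrMr; lra.
  exact: expR_ge1Dx.
rewrite -!expRM_natl -expRD ler_expR natrB//.
set N : R := n%:R in mM *; set M : R := m%:R in mM *.
have N0 : 0 <= N by rewrite ler0n.
apply: (@le_trans _ _ (N * (q * h (e / q) + eta * (e * l) + (1 + eta) * e * b))).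
  have -> : q * h (e / q) = (q + e) * l - e.
    by rewrite hE -/l; [field; rewrite gt_eqF|lra].
  have : 0 <= (N * (q + (1 + eta) * e) - M) * (l + b) by rewrite mulr_ge0//; lra.
  have : N * (b * (1 - q)) = N * e by rewrite bE.
  nra.
rewrite -[leRHS]mulrA; apply: ler_wpM2l => //.
have H1 : e * l <= q * (4 * h (e / q)).
  have := ler_wpM2l (ltW q0) (mul_ln1D_le _ (ltW x0)).
  by rewrite -/l (_ : q * (e / q * l) = e * l)//; field; rewrite gt_eqF.
have H2 : e ^+ 2 <= q * h (e / q) * (2 * (2 * q + e)).
  have := h_ge _ (ltW x0); rewrite ler_pdivrMr; last lra.
  move=> /(ler_wpM2l (sqr_ge0 q)).
  have -> : q ^+ 2 * (e / q) ^+ 2 = e ^+ 2 by field; rewrite gt_eqF.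
  by move=> /le_trans; apply; rewrite le_eqVlt; apply/orP; left; apply/eqP; field; rewrite gt_eqF.
have H3 : (1 + eta) * e * b <= 4 * e ^+ 2.
  have : e * b <= e * (2 * e) by rewrite ler_pM2l.
  have eb0 : 0 <= e * b by rewrite mulr_ge0// ltW.
  nra.
have : eta * (e * l) <= eta * (q * (4 * h (e / q))) by rewrite ler_wpM2l.
lra.
Qed.

End HScale.

(** * Sorted probability vectors *)

Section SortedSimplex.
Context {R : realType}.
Variables n p : nat.
Variable q : 'rV[R]_p.
Hypothesis n_gt0 : (0 < n)%N.
Hypothesis p_gt1 : (1 < p)%N.
Hypothesis sq : simplex q.
Hypothesis q_sorted : forall i j : 'I_p, (i <= j)%N -> q 0 j <= q 0 i.
Hypothesis q_ge : forall j, n%:R^-1 <= q 0 j.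

Lemma qminusE (j : 'I_p) : qminus q j = q 0 j.
Proof. by rewrite /qminus valK. Qed.

Lemma sorted_coord_le (j : 'I_p) : j.+1%:R * q 0 j <= 1.
Proof.
have [_ q1] := sq.
rewrite -[leRHS]q1 [leRHS](bigID (fun k : 'I_p => (k < j.+1)%N))/= -[leLHS]addr0.
apply: lerD; last by apply: sumr_ge0 => k _; exact: simplex_ge0.
rewrite (big_ord_narrow (ltn_ord j)) mulr_natl -[in leLHS](card_ord j.+1) -sumr_const.
by apply: ler_sum => k _; apply: q_sorted; rewrite /= -ltnS.
Qed.

Lemma coord_gt0 j : 0 < q 0 j.
Proof. by apply: lt_le_trans (q_ge j); rewrite invr_gt0 ltr0n. Qed.

Lemma coord_tail_le (j : 'I_p) : (0 < j)%N -> q 0 j <= 1 / 2.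
Proof.
move=> j0; rewrite ler_pdivlMr// mulrC; apply: le_trans (sorted_coord_le j).
by rewrite ler_wpM2r ?ler_nat// ltW// coord_gt0.
Qed.

(** A coordinate other than the largest one is at most qmax and, as the sum is 1,
at most 1 - qmax. *)
Lemma coord_var_le (j : 'I_p) : q 0 j * (1 - q 0 j) <= qmax q * (1 - qmax q).
Proof.
pose j0 : 'I_p := Ordinal (ltnW p_gt1).
have E : qmax q = q 0 j0.
  apply/eqP; rewrite eq_le; apply/andP; split; last exact: le_bigmax.
  by apply: bigmax_le => [|k _]; [exact: ltW (coord_gt0 _)|exact: q_sorted].
rewrite E; have [->//|jj0] := eqVneq j j0.
have j_gt0 : (0 < j)%N by rewrite lt0n; apply: contraNneq jj0 => jz; apply/eqP/val_inj.
have q1 : q 0 j <= q 0 j0 by apply: q_sorted.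
have q2 := coord_tail_le j j_gt0.
have q3 : q 0 j0 + q 0 j <= 1.
  have [_ <-] := sq; rewrite (bigD1 j0)//= (bigD1 j)//= addrA lerDl sumr_ge0// => k _.
  exact: ltW (coord_gt0 _).
rewrite -subr_ge0.
have -> : q 0 j0 * (1 - q 0 j0) - q 0 j * (1 - q 0 j) =
    (q 0 j0 - q 0 j) * (1 - q 0 j0 - q 0 j) by ring.
by rewrite mulr_ge0//; lra.
Qed.

Lemma qmax_var_ge : 1 / 2 <= n%:R * (qmax q * (1 - qmax q)).
Proof.
pose j1 : 'I_p := Ordinal p_gt1.
apply: (@le_trans _ _ (n%:R * (q 0 j1 * (1 - q 0 j1)))); last first.
  by rewrite ler_wpM2l// coord_var_le.
have n0 : 0 < n%:R :> R by rewrite ltr0n.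
have H : 1 <= n%:R * q 0 j1 by rewrite -ler_pdivrMl// mulr1.
have H2 := coord_tail_le j1 (ltnSn 0).
rewrite mulrA; nra.
Qed.

Lemma qmax_var_gt0 : 0 < qmax q * (1 - qmax q).
Proof.
have n0 : 0 < n%:R :> R by rewrite ltr0n.
by rewrite -(pmulr_rgt0 _ n0); have := qmax_var_ge; lra.
Qed.

(** As n V >= 1/2, the standard deviation s = sqrt (V / n) satisfies n s >= 1/2, so
both V and eps are small compared with n eps^2 when r = eps / s is large. *)
Lemma bernstein_exponent_ge (eps : R) :
  let V := qmax q * (1 - qmax q) in
  let r := eps / Num.sqrt (V / n%:R) in
  1 <= r -> 0 < eps /\ r / 16 <= bernstein_exponent n V eps.
Proof.
move=> V r r1.
have V0 : 0 < V by exact: qmax_var_gt0.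
have n0 : 0 < n%:R :> R by rewrite ltr0n.
have nV : 1 / 2 <= n%:R * V by exact: qmax_var_ge.
have Vn : 0 < V / n%:R by rewrite divr_gt0.
set s := Num.sqrt (V / n%:R) in r r1 *.
have s0 : 0 < s by rewrite sqrtr_gt0.
have s2 : n%:R * s ^+ 2 = V by rewrite sqr_sqrtr ?ltW// mulrC divfK// gt_eqF.
have er : eps = r * s by rewrite /r divfK// gt_eqF.
split; first by rewrite er mulr_gt0//; lra.
have ns : 1 <= 2 * (n%:R * s).
  have : 1 / 2 <= (n%:R * s) ^+ 2 by rewrite exprMn expr2 -mulrA s2.
  have : 0 < n%:R * s by rewrite mulr_gt0.
  nra.
rewrite /bernstein_exponent -s2 er ler_pdivlMr; last first.
  have r0 : 0 < r by lra.
  have rs0 : 0 < r * s by rewrite mulr_gt0.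
  by rewrite s2; lra.
have r0 : 0 < r by lra.
have P : 0 <= n%:R * s ^+ 2 by rewrite mulr_ge0 ?sqr_ge0.
have H1 : r * s <= 2 * (n%:R * s ^+ 2) * r.
  have : r * s * 1 <= r * s * (2 * (n%:R * s)) by rewrite ler_pM2l// mulr_gt0.
  lra.
have H2 : n%:R * s ^+ 2 * r <= n%:R * s ^+ 2 * r ^+ 2.
  by rewrite ler_wpM2l// expr2 ler_pMr.
have H3 : r * (r * s) <= r * (2 * (n%:R * s ^+ 2) * r) by rewrite ler_pM2l.
lra.
Qed.

Lemma epsilon_ge (xi : R) j : 0 <= xi -> (1 <= j < p)%N ->
  xi * hscale n (qminus q j) (ln (expR 1 * j%:R)) <= epsilon xi n q.
Proof.
move=> xi0 /andP[j1 jp]; rewrite ler_wpM2l//.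
apply: (@le_bigmax_seq _ _ _ _ _ j) => //.
by rewrite mem_index_iota j1.
Qed.

Lemma epsilon_le (xi D : R) : 0 <= xi -> 0 <= D ->
  (forall j, (1 <= j < p)%N -> hscale n (qminus q j) (ln (expR 1 * j%:R)) <= D) ->
  epsilon xi n q <= xi * D.
Proof.
move=> xi0 D0 H; rewrite ler_wpM2l// big_seq_cond bigmax_le// => j.
by rewrite mem_index_iota andbT => /H.
Qed.

End SortedSimplex.

Lemma big_ord_neq0 (R : realType) p (j0 : 'I_p) (F : nat -> R) : j0 = 0%N :> nat ->
  \sum_(j < p | j != j0) F j = \sum_(1 <= j < p) F j.
Proof.
case: p j0 => [[]//|p] j0 jz.
rewrite big_add1/= big_mkord big_mkcond big_ord_recl/=.
have -> : j0 = ord0 by exact: val_inj.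
by rewrite eqxx add0r; apply: eq_bigr => k _.
Qed.

(** * Risk bounds for a fixed sample size *)

Lemma leq_double_sub_half m : (m <= 2 * (m - m./2))%N.
Proof. by lia. Qed.

Lemma half_lt_leq m k : (m./2 < k -> m <= 2 * k.+1)%N.
Proof. by lia. Qed.

Section FiniteBounds.
Context {R : realType}.
Variables n p : nat.
Variable q : 'rV[R]_p.
Hypothesis n_gt0 : (0 < n)%N.
Hypothesis p_gt1 : (1 < p)%N.
Hypothesis sq : simplex q.
Hypothesis q_sorted : forall i j : 'I_p, (i <= j)%N -> q 0 j <= q 0 i.
Hypothesis q_ge : forall j, n%:R^-1 <= q 0 j.

Variables (alpha xi : R) (js : 'I_p).
Hypothesis alpha_ge1 : 1 <= alpha.
Hypothesis xi_gt0 : 0 < xi.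
Hypothesis jsP : is_jstar n q alpha js.

Let eps := epsilon xi n q.
Let V := qmax q * (1 - qmax q).
Let G := bernstein_exponent n V eps.
Let L : R := ln js%:R.

Lemma alpha_gt0 : 0 < alpha. Proof. exact: lt_le_trans alpha_ge1. Qed.

Definition log_weight (j : nat) : R :=
  let ej := expR 1 * j%:R in ln (ej * alpha * ln ej ^+ 2).

Lemma ln_expR1M (j : nat) : (0 < j)%N -> ln (expR 1 * j%:R) = 1 + ln j%:R :> R.
Proof. by move=> j0; rewrite lnM ?posrE ?expR_gt0 ?ltr0n// expRK. Qed.

Lemma ln_nat_ge0 (j : nat) : (0 < j)%N -> 0 <= ln j%:R :> R.
Proof. by move=> j0; rewrite ln_ge0// ler1n. Qed.

Lemma expR_log_weight (j : nat) : (0 < j)%N ->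
  expR (- log_weight j) = (expR 1 * alpha)^-1 * (j%:R * (1 + ln j%:R) ^+ 2)^-1.
Proof.
move=> j0; rewrite /log_weight ln_expR1M//.
have j1 : 0 < j%:R :> R by rewrite ltr0n.
have := ln_nat_ge0 j j0 => l0.
rewrite expRN lnK; last first.
  by have a0 := alpha_gt0; rewrite posrE !mulr_gt0 ?expR_gt0 ?exprn_gt0//; lra.
by rewrite -invfM; congr (_^-1); ring.
Qed.

Lemma log_weightE (j : nat) : (0 < j)%N ->
  log_weight j = (1 + ln j%:R) + (ln alpha + 2 * ln (1 + ln j%:R)).
Proof.
move=> j0; rewrite /log_weight ln_expR1M//.
have j1 : 0 < j%:R :> R by rewrite ltr0n.
have a0 := alpha_gt0.
have := ln_nat_ge0 j j0 => l0.
have l1 : 0 < 1 + ln j%:R :> R by lra.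
have ej0 : 0 < expR 1 * j%:R :> R by rewrite mulr_gt0 ?expR_gt0.
have l2 : 0 < (1 + ln j%:R) ^+ 2 :> R by rewrite exprn_gt0.
have eja0 : 0 < expR 1 * j%:R * alpha by rewrite mulr_gt0.
by rewrite lnM ?posrE// lnM ?posrE// ln_expR1M// lnXn// -[ln (1 + _) *+ 2]mulr_natl addrA.
Qed.

Lemma log_weight_ge (j : nat) : (0 < j)%N -> 1 + ln j%:R <= log_weight j.
Proof.
move=> j0; rewrite log_weightE// lerDl addr_ge0 ?ln_ge0//.
by rewrite mulr_ge0// ln_ge0// lerDl ln_nat_ge0.
Qed.

Let js_gt0 : (0 < js)%N. Proof. by case: jsP => /andP[]. Qed.
Let L_ge0 : 0 <= L. Proof. exact: ln_nat_ge0. Qed.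

(** The relative increase from log (e j) to log (e j alpha log^2 (e j)) at the
maximizer. *)
Definition excess : R := (ln alpha + 2 * ln (1 + L)) / (1 + L).

Lemma excess_ge0 : 0 <= excess.
Proof.
have L0 := L_ge0.
have H1 : 0 <= ln alpha by rewrite ln_ge0.
have H2 : 0 <= ln (1 + L) by rewrite ln_ge0// lerDl.
by rewrite /excess divr_ge0//; lra.
Qed.

Lemma coord_in01 (j : 'I_p) : (0 < j)%N -> 0 < q 0 j < 1.
Proof.
move=> j0; rewrite (coord_gt0 n p q n_gt0 q_ge)/=.
by have := coord_tail_le n p q n_gt0 sq q_sorted q_ge j j0; lra.
Qed.

Lemma jstar_objective_bound :
  hscale n (q 0 js) (log_weight js) <= (1 + excess) * hscale n (q 0 js) (1 + L).
Proof.
have L0 := L_ge0; have x0 := excess_ge0.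
have -> : log_weight js = (1 + excess) * (1 + L).
  rewrite log_weightE// -/L /excess; field.
  by rewrite gt_eqF//; lra.
by apply: hscale_mulr_le => //; [exact: coord_in01|lra..].
Qed.

Lemma hscale_weight_le (j : 'I_p) : (0 < j)%N ->
  hscale n (q 0 j) (log_weight j) <= hscale n (q 0 js) (log_weight js).
Proof.
move=> j0; case: jsP => _ /(_ j); rewrite j0 ltn_ord => /(_ isT).
by rewrite /jstar_objective !qminusE.
Qed.

Lemma jstar_objective_le_epsilon :
  xi * hscale n (q 0 js) (log_weight js) <= (1 + excess) * eps.
Proof.
have x0 := excess_ge0.
apply: (@le_trans _ _ ((1 + excess) * (xi * hscale n (q 0 js) (1 + L)))).
  by rewrite [leRHS]mulrCA ler_pM2l// jstar_objective_bound.
apply: ler_wpM2l; first lra.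
have := epsilon_ge n p q xi js (ltW xi_gt0); rewrite js_gt0 ltn_ord => /(_ isT).
by rewrite qminusE ln_expR1M.
Qed.

Lemma epsilon_le_jstar : eps <= xi * (1 + excess) * hscale n (q 0 js) (1 + L).
Proof.
rewrite -mulrA; have L0 := L_ge0.
apply: (@le_trans _ _ (xi * hscale n (q 0 js) (log_weight js))); last first.
  by rewrite ler_pM2l// jstar_objective_bound.
have w0 : 0 <= log_weight js by apply: le_trans (log_weight_ge js js_gt0); rewrite -/L; lra.
apply: epsilon_le; first exact: ltW.
  by have [] := hscaleP n (q 0 js) (log_weight js) n_gt0 (coord_in01 js js_gt0) w0.
move=> j /andP[j1 jp]; apply: le_trans (hscale_weight_le (Ordinal jp) j1).
rewrite -(qminusE p q (Ordinal jp)) ln_expR1M//.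
have lj := ln_nat_ge0 j j1.
apply: hscale_le => //; [|lra|exact: log_weight_ge].
by rewrite (qminusE p q (Ordinal jp)); apply: coord_in01.
Qed.

(** The factor n' / n of the hypothesis converts the thresholds, which are defined
with n' observations, to the actual sample size. *)
Lemma minimax_risk_upper_finite (s : R) : 0 < s < 1 ->
  1 <= eps / Num.sqrt (V / n%:R) ->
  nprime n * (1 + excess) <= n%:R * (s * xi) ->
  minimax_risk eps n q <=
    4 / alpha + 2 * expR (- (s ^+ 2 * G)) + 2 * expR (- ((1 - s) ^+ 2 * G)).
Proof.
move=> s01 r1 Hs; have /andP[s0 s1] := s01.
have [e0 _] := bernstein_exponent_ge n p q n_gt0 p_gt1 sq q_sorted q_ge eps r1.
pose j0 : 'I_p := Ordinal (ltnW p_gt1).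
have n0 : 0 < n%:R :> R by rewrite ltr0n.
have N0 : 0 < nprime n :> R by apply: lt_le_trans (nprime_ge n).
have V0 : 0 < V := qmax_var_gt0 n p q n_gt0 p_gt1 sq q_sorted q_ge.
have a0 := alpha_gt0.
have x0 := excess_ge0.
apply: (le_trans (minimax_risk_upper n p q j0 eps V s
  (fun j => log_weight j) sq e0 V0 _ s01 _)).
- by move=> j; exact: (coord_var_le n p q n_gt0 p_gt1 sq q_sorted q_ge).
- move=> j jj0 /=.
  have j_gt0 : (0 < j)%N by rewrite lt0n; apply: contraNneq jj0 => jz; apply/eqP/val_inj.
  have /andP[qj0 qj1] := coord_in01 j j_gt0.
  have v0 : 0 < q 0 j * (1 - q 0 j) by rewrite mulr_gt0//; lra.
  split=> //; set v := q 0 j * _ in v0 *.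
  have w0 : 0 <= log_weight j.
    by apply: le_trans (log_weight_ge j j_gt0); have := ln_nat_ge0 j j_gt0; lra.
  have [d0 dK] := hscaleP n (q 0 j) (log_weight j) n_gt0 (coord_in01 j j_gt0) w0.
  rewrite -[leLHS]dK -/v; set d := hscale _ _ _ in d0 *.
  pose a : R := nprime n / n%:R.
  have a1 : 1 <= a by rewrite ler_pdivlMr// mul1r nprime_ge.
  have ap : 0 < a by lra.
  have -> : nprime n = n%:R * a by rewrite mulrC divfK// gt_eqF.
  rewrite -mulrA ler_pM2l// mulrCA ler_pM2l//.
  have dv0 : 0 <= a * (d / v) by rewrite mulr_ge0 ?divr_ge0//; lra.
  have := h_scale_le a^-1 (a * (d / v)).
  rewrite mulKf ?gt_eqF// invr_ge0 (ltW ap) invf_le1// => /(_ a1 dv0).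
  rewrite ler_pdivlMl// => /le_trans; apply.
  apply: h_le => //; rewrite mulrA ler_pM2r ?invr_gt0//.
  have dD : d <= hscale n (q 0 js) (log_weight js) by exact: hscale_weight_le.
  have H1 := jstar_objective_le_epsilon.
  have aN : a * (1 + excess) <= s * xi.
    by rewrite /a mulrAC ler_pdivrMr// [leRHS]mulrC.
  rewrite -(ler_pM2l xi_gt0).
  have H2 : a * (xi * d) <= a * ((1 + excess) * eps).
    by rewrite ler_pM2l//; apply: le_trans H1; rewrite ler_pM2l.
  have H3 : a * (1 + excess) * eps <= s * xi * eps by rewrite ler_pM2r.
  lra.
rewrite -!addrA lerD2r.
rewrite -mulr_sumr (big_ord_neq0 R p j0 (fun j => expR (- log_weight j)))//.
have -> : \sum_(1 <= j < p) expR (- log_weight j) =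
    (expR 1 * alpha)^-1 * \sum_(1 <= j < p) (j%:R * (1 + ln j%:R) ^+ 2)^-1.
  rewrite mulr_sumr big_nat_cond [RHS]big_nat_cond; apply: eq_bigr => j.
  by rewrite andbT => /andP[j1 _]; exact: expR_log_weight.
have -> : 4 / alpha = 2 * (alpha^-1 * 2) by ring.
rewrite ler_pM2l//; apply: ler_pM.
- by rewrite invr_ge0 mulr_ge0 ?expR_ge0// ltW.
- apply: sumr_ge0 => j _; by rewrite invr_ge0 mulr_ge0 ?sqr_ge0.
- rewrite lef_pV2 ?posrE ?mulr_gt0 ?expR_gt0// ler_peMl//; first lra.
  by have := expR_ge1Dx (1 : R); lra.
exact: sum_inv_mul_sqr_ln.
Qed.

Section LowerBound.
Variable xi' : R.
Hypothesis xi'_lt1 : xi' <= 1.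
Hypothesis xi_le : xi * (1 + excess) <= xi'.
Hypothesis eps_gt0 : 0 < eps.

(** As the vector is sorted, q 0 i is at least the variance v of the maximizer, so
the exponent of the spike is at most that for v; there eps is at most xi' times
the threshold of exponent 1 + L, and convexity of h brings xi' outside. *)
Lemma spike_rate_le (i : 'I_p) : (i <= js)%N ->
  n%:R * (q 0 i * h (eps / q 0 i)) <= xi' * (1 + L).
Proof.
move=> ij; have L0 := L_ge0.
have /andP[qs0 qs1] := coord_in01 js js_gt0.
set v := q 0 js * (1 - q 0 js).
have v0 : 0 < v by rewrite mulr_gt0//; lra.
have vq : v <= q 0 i.
  by apply: le_trans (q_sorted _ _ ij); rewrite /v ler_piMr//; lra.
have n0 : 0 <= n%:R :> R by [].
have xi'0 : 0 <= xi'.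
  by apply: le_trans xi_le; rewrite mulr_ge0 ?addr_ge0 ?excess_ge0// ltW.
have L1 : 0 <= 1 + L by lra.
have [d0 dK] := hscaleP n (q 0 js) (1 + L) n_gt0 (coord_in01 js js_gt0) L1.
rewrite -/v in dK; set d := hscale _ _ _ in d0 dK.
have ed : eps <= xi' * d.
  by apply: (le_trans epsilon_le_jstar); rewrite ler_wpM2r.
apply: (@le_trans _ _ (n%:R * (xi' * (v * h (d / v))))).
  apply: ler_wpM2l => //.
  apply: (le_trans (h_perspective_le _ _ _ v0 vq (ltW eps_gt0))).
  rewrite mulrCA ler_pM2l//.
  apply: le_trans (h_scale_le xi' (d / v) _ _).
  - by apply: h_le; [rewrite divr_ge0 ?ltW|rewrite mulrA ler_pM2r ?invr_gt0].
  - by rewrite xi'0.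
  - by rewrite divr_ge0// ltW.
rewrite mulrCA ler_wpM2l// -[leRHS]dK ler_wpM2r ?nprime_ge//.
have dv0 : 0 <= d / v by rewrite divr_ge0// ltW.
by rewrite mulr_ge0 ?h_ge0// ltW.
Qed.

(** The rate bound at the maximizer itself, combined with h_ge; it forces eps to 0
because (1 + log j* ) / n tends to 0. *)
Lemma epsilon_sqr_le : n%:R * eps ^+ 2 <= 2 * (1 + eps) * (1 + L).
Proof.
have L0 := L_ge0.
have e0 := eps_gt0.
have x1 := xi'_lt1.
have /andP[q0 _] := coord_in01 js js_gt0.
have q1 := coord_tail_le n p q n_gt0 sq q_sorted q_ge js js_gt0.
set u := q 0 js in q0 q1.
have := h_ge (eps / u) (ltW (divr_gt0 e0 q0)).
have -> : (eps / u) ^+ 2 / (2 * (2 + eps / u)) = eps ^+ 2 / (u * (2 * (2 * u + eps))).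
  by field; rewrite !gt_eqF//; lra.
rewrite ler_pdivrMr; last by rewrite mulr_gt0//; lra.
have n0 : 0 <= n%:R :> R by [].
move=> /(ler_wpM2l n0) /le_trans; apply.
have := spike_rate_le js (leqnn _); rewrite -/u => H.
apply: (@le_trans _ _ (xi' * (1 + L) * (2 * (2 * u + eps)))).
  rewrite (_ : n%:R * _ = n%:R * (u * h (eps / u)) * (2 * (2 * u + eps))); last by ring.
  by rewrite ler_wpM2r//; lra.
have L1 : xi' * (1 + L) <= 1 * (1 + L) by rewrite ler_wpM2r//; lra.
have : (1 + L) * (2 * (2 * u + eps)) <= (1 + L) * (2 * (1 + eps)) by rewrite ler_wpM2l//; lra.
have : xi' * (1 + L) * (2 * (2 * u + eps)) <= 1 * (1 + L) * (2 * (2 * u + eps)).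
  by rewrite ler_wpM2r//; lra.
lra.
Qed.

(** Only indices above j*/2 are used: there q 0 i <= 2 / j*, which makes the
relative error 8 (2 q + eps) of lr_truncated_le small, and at least half of the
indices up to j* remain. *)
Lemma minimax_risk_lower_finite (eta d c : R) :
  1 <= eps / Num.sqrt (V / n%:R) ->
  0 < eta <= 1 -> 0 < c -> d <= 1 / 2 -> 4 / js%:R + eps <= d ->
  1 - c / 2 - (4 * expR (- (eta ^+ 2 * G)) +
     2 * expR (xi' * (1 + 4 * eta + 8 * d) * (1 + L)) / js%:R) / (2 * c)
  <= minimax_risk eps n q.
Proof.
move=> r1 eta01 c0 d1 Hd.
have L0 := L_ge0.
have e0 := eps_gt0.
have J0 : 0 < js%:R :> R by rewrite ltr0n.
have V0 : 0 < V := qmax_var_gt0 n p q n_gt0 p_gt1 sq q_sorted q_ge.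
pose J : {set 'I_p} := [set i : 'I_p | (js./2 < i)%N && (i <= js)%N]%SET.
have cardJ : (js <= 2 * #|J|)%N.
  have -> : #|J| = (js - js./2)%N.
    rewrite /J cardsE -sum1_card.
    rewrite -(@big_ord_widen_cond _ _ _ js.+1 p (fun i => js./2 < i)%N (fun=> 1%N)) ?ltn_ord//.
    have := @big_geq_mkord _ 0%N addn js./2.+1 js.+1 xpredT (fun=> 1%N).
    by rewrite /= => <-; rewrite sum_nat_const_nat muln1 subSS.
  exact: leq_double_sub_half.
have J1 : (0 < #|J|)%N.
  move: cardJ; case: #|J| => //; rewrite muln0 leqn0 => /eqP jz.
  by move: js_gt0; rewrite jz.
set B := expR (_ * (1 + L)).
have := @minimax_risk_lower R n p q eps sq e0 J V eta B c J1 V0 eta01 c0.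
have Jq i : i \in J -> 0 < q 0 i /\ q 0 i <= 2 / js%:R.
  rewrite inE => /andP[ij _]; split; first exact: (coord_gt0 n p q).
  rewrite ler_pdivlMr// mulrC.
  have : js%:R <= 2 * i.+1%:R :> R.
    by rewrite -natrM ler_nat half_lt_leq.
  have := sorted_coord_le p q sq q_sorted i.
  have := coord_gt0 n p q n_gt0 q_ge i.
  move: (q 0 i) => u u0 H1 H2; have := ler_wpM2r (ltW u0) H2; lra.
have js4 : 0 < 4 / js%:R :> R by rewrite divr_gt0.
have q_half i : i \in J -> q 0 i <= 1 / 2.
  by move=> /Jq[_ H]; apply: le_trans H _; lra.
move=> /(_ _ _)/(le_trans _); apply.
- rewrite lerD2l lerN2 ler_wpM2r ?invr_ge0//; first lra.
  have B0 : 0 <= B by exact: expR_ge0.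
  have cJ : js%:R <= 2 * #|J|%:R :> R by rewrite -natrM ler_nat.
  have : B / #|J|%:R <= 2 * B / js%:R.
    rewrite ler_pdivlMr// mulrAC ler_pdivrMr ?ltr0n//.
    have := ler_wpM2l B0 cJ; lra.
  rewrite /G; lra.
- move=> i iJ; have [qi0 qi2] := Jq i iJ; split; last exact: (coord_var_le n p q).
  by split=> //; have := q_half i iJ; lra.
move=> i iJ m mn mM; have [qi0 qi2] := Jq i iJ.
have qh := q_half i iJ.
apply: (le_trans (lr_truncated_le n m (q 0 i) eps eta _ e0 _ _ mn mM)).
- by rewrite qi0.
- lra.
- by case/andP: eta01 => /ltW -> ->.
rewrite ler_expR.
have [t0 t1] := andP eta01.
have rate : n%:R * (q 0 i * h (eps / q 0 i)) <= xi' * (1 + L).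
  by apply: spike_rate_le; move: iJ; rewrite inE => /andP[].
have r0 : 0 <= n%:R * (q 0 i * h (eps / q 0 i)).
  by rewrite !mulr_ge0 ?h_ge0 ?divr_ge0// ltW.
have D : 2 * q 0 i + eps <= d by lra.
apply: (@le_trans _ _ (xi' * (1 + L) * (1 + 4 * eta + 8 * (2 * q 0 i + eps)))).
  by rewrite ler_wpM2r//; lra.
rewrite [leRHS]mulrAC ler_wpM2l//; lra.
Qed.
End LowerBound.
End FiniteBounds.

(** * Asymptotics *)

Section Asymptotics.
Context {R : realType}.
Implicit Types x y K : R.

Lemma expRN_le_inv y : 0 < y -> expR (- y) <= y^-1.
Proof.
move=> y0; rewrite expRN lef_pV2 ?posrE ?expR_gt0//.
by have := expR_ge1Dx y; lra.
Qed.

(** 1 / e = (expR (- 1/8))^8 >= (7/8)^8 > 1/3. *)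
Lemma expR1_lt3 : expR 1 < 3 :> R.
Proof.
have H : 7 / 8 <= expR (- (1 / 8)) :> R by have := expR_ge1Dx (- (1 / 8) : R); lra.
have E : expR (- 1) = expR (- (1 / 8)) ^+ 8 :> R.
  by rewrite -expRM_natl; congr expR; lra.
have : (7 / 8) ^+ 8 <= expR (- 1) :> R.
  by rewrite E lerXn2r ?nnegrE ?expR_ge0//; lra.
rewrite expRN => H2.
rewrite -ltf_pV2 ?posrE ?expR_gt0//; apply: lt_le_trans H2; lra.
Qed.

Lemma ln3_gt1 : 1 < ln 3 :> R.
Proof. by rewrite -[X in X < _](expRK 1) ltr_ln ?posrE ?expR_gt0// expR1_lt3. Qed.

Lemma ln_sqr_le y : 1 <= y -> ln y ^+ 2 <= 2 * y.
Proof.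
move=> y1; have := expR_ge1Dxn 1 (ln_ge0 y1).
rewrite lnK ?posrE ?(lt_le_trans ltr01)// (_ : 2`! = 2)%N//; lra.
Qed.

(** A positive ratio forces ln j > 1, hence j >= 3 and ln (ln j) >= ln (ln 3) > 0
because j is an integer.  This constant lower bound makes the ratio control
both the growth of ln j and that of a relatively to ln j. *)
Lemma jstar_growth (j : nat) (a K : R) : 1 <= K -> 1 <= a -> (0 < j)%N ->
  32 * K ^+ 2 / ln (ln 3) <= ln j%:R / (a * ln (ln j%:R)) ->
  K <= ln j%:R /\ (a + 2 * ln (1 + ln j%:R)) / (1 + ln j%:R) <= K^-1.
Proof.
move=> K1 a1 j0; set L : R := ln j%:R; set k : R := ln (ln 3) => HT.
have k0 : 0 < k by rewrite ln_gt0// ln3_gt1.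
have L0 : 0 <= L by rewrite ln_ge0// ler1n.
have T0 : 0 < 32 * K ^+ 2 / k by rewrite divr_gt0// mulr_gt0// exprn_gt0//; lra.
have LT := lt_le_trans T0 HT.
have L_gt0 : 0 < L.
  by rewrite lt_neqAle L0 andbT; apply/eqP => E; move: LT; rewrite -E mul0r ltxx.
have lnL : 0 < ln L.
  have : 0 < a * ln L by rewrite -invr_gt0 -(pmulr_rgt0 _ L_gt0).
  by rewrite pmulr_rgt0//; lra.
have L1 : 1 < L.
  rewrite ltNge; apply/negP => /(ln_le0); lra.
have j3 : (3 <= j)%N.
  rewrite ltnNge; apply/negP => j2; move: L1; rewrite ltNge => /negP; apply.
  have : ln j%:R <= j%:R - 1 :> R by apply: ln_le_sub1; rewrite ltr0n.
  have : j%:R <= 2 :> R by rewrite (ler_nat _ _ 2).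
  rewrite -/L; lra.
have kL : k <= ln L.
  rewrite ler_ln ?posrE//; last by have := ln3_gt1; lra.
  by rewrite ler_ln ?posrE ?ltr0n// (ler_nat _ 3).
have K2 : K <= K ^+ 2 by rewrite expr2 ler_peMl//; lra.
have P : 32 * K ^+ 2 * a <= L.
  move: HT; rewrite ler_pdivlMr; last by rewrite mulr_gt0//; lra.
  apply: le_trans.
  have -> : 32 * K ^+ 2 / k * (a * ln L) = 32 * K ^+ 2 * a * (ln L / k) by ring.
  by rewrite ler_peMr ?mulr_ge0 ?sqr_ge0// ?ler_pdivlMr ?mul1r//; lra.
have K0 : 0 < K by lra.
have PK : 32 * K ^+ 2 <= L.
  apply: le_trans P; rewrite ler_peMr// mulr_ge0 ?sqr_ge0//.
split; first by lra.
set y : R := 1 + L; have y1 : 1 <= y by rewrite /y; lra.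
have y0 : 0 < y by lra.
(* The factor 32 is chosen so that ln_sqr_le turns y >= 32 K^2 into
   2 ln y <= y / (2 K); the term a gets the other half of 1 / K. *)
have w2 : (4 * K * ln y) ^+ 2 <= y ^+ 2.
  have := ln_sqr_le y y1 => H.
  have : 32 * K ^+ 2 * y <= y * y by rewrite ler_pM2r// /y; lra.
  have : 16 * K ^+ 2 * ln y ^+ 2 <= 16 * K ^+ 2 * (2 * y).
    by rewrite ler_wpM2l// mulr_ge0 ?sqr_ge0.
  lra.
have w : 4 * K * ln y <= y.
  by move: w2; rewrite ler_pXn2r ?nnegrE ?mulr_ge0 ?ln_ge0// ltW.
have aK : 32 * K * a <= y.
  have : 32 * (K * a) <= 32 * (K ^+ 2 * a) by rewrite ler_pM2l// ler_pM2r//; lra.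
  rewrite /y; lra.
rewrite ler_pdivrMr// ler_pdivlMl//; lra.
Qed.

Lemma powR_third_le (n : nat) K : 1 <= K -> K ^+ 3 <= n%:R -> n%:R `^ (- (1 / 3)) <= K^-1.
Proof.
move=> K1 Kn; have K0 : 0 < K by lra.
have n0 : 0 < n%:R :> R by apply: lt_le_trans Kn; rewrite exprn_gt0.
rewrite powRN lef_pV2 ?posrE ?powR_gt0//.
have -> : K = (K ^+ 3) `^ (1 / 3).
  by rewrite -powR_mulrn ?ltW// -powRrM mulrC divfK// powRr1 ?ltW.
by apply: ge0_ler_powR => //; rewrite ?nnegrE ?exprn_ge0 ?ltW//; lra.
Qed.

End Asymptotics.

Section Regime.
Context {R : realType}.
Variables n p : nat.
Variable q : 'rV[R]_p.
Hypothesis n_gt0 : (0 < n)%N.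
Hypothesis p_gt1 : (1 < p)%N.
Hypothesis sq : simplex q.
Hypothesis q_sorted : forall i j : 'I_p, (i <= j)%N -> q 0 j <= q 0 i.
Hypothesis q_ge : forall j, n%:R^-1 <= q 0 j.
Variables (alpha xi : R) (js : 'I_p) (K : R).
Hypothesis jsP : is_jstar n q alpha js.
Hypothesis xi_gt0 : 0 < xi.
Let eps := epsilon xi n q.
Let V := qmax q * (1 - qmax q).
Let G := bernstein_exponent n V eps.
Let L : R := ln js%:R.
Hypothesis K_ge1 : 1 <= K.
Hypothesis alpha_ge : K <= alpha.
Hypothesis excess_le : excess p alpha js <= K^-1.
Hypothesis L_ge : K <= L.
Hypothesis r_ge : K <= eps / Num.sqrt (V / n%:R).

Let K_gt0 : 0 < K. Proof. exact: lt_le_trans K_ge1. Qed.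
Let alpha_ge1 : 1 <= alpha. Proof. exact: le_trans K_ge1 alpha_ge. Qed.
Let r_ge1 : 1 <= eps / Num.sqrt (V / n%:R). Proof. exact: le_trans K_ge1 r_ge. Qed.

Lemma expRN_exponent_le (c : R) : 0 < c -> expR (- (c ^+ 2 * G)) <= 16 / c ^+ 2 / K.
Proof.
move=> c0; have K0 := K_gt0; have Kr := r_ge.
have [_ GK] := bernstein_exponent_ge n p q n_gt0 p_gt1 sq q_sorted q_ge eps r_ge1.
have c2 : 0 < c ^+ 2 by rewrite exprn_gt0.
have G16 : K / 16 <= G by apply: le_trans GK; rewrite ler_pM2r.
have GG : c ^+ 2 * (K / 16) <= c ^+ 2 * G by rewrite ler_pM2l.
have P : 0 < c ^+ 2 * (K / 16) by rewrite mulr_gt0// divr_gt0.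
apply: (@le_trans _ _ (expR (- (c ^+ 2 * (K / 16))))); first by rewrite ler_expR lerN2.
apply: le_trans (expRN_le_inv _ P) _.
by rewrite le_eqVlt; apply/orP; left; apply/eqP; field; rewrite !gt_eqF.
Qed.

(** s is the midpoint of 1 / xi and 1, so that s xi = (1 + xi) / 2 leaves room
above 1 for both n' / n and the excess. *)
Lemma minimax_risk_upper_regime (s : R) : s = (1 + xi^-1) / 2 ->
  1 < xi -> 6 / (xi - 1) <= K -> n%:R `^ (- (1 / 3)) <= K^-1 ->
  minimax_risk eps n q <= (4 + 32 / s ^+ 2 + 32 / (1 - s) ^+ 2) / K.
Proof.
move=> sE xi1 HK Hn; have K0 := K_gt0; have xiK := mulfV (lt0r_neq0 xi_gt0).
have xi0 := xi_gt0.
have sxi : s * xi = (xi + 1) / 2.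
  by rewrite sE mulrAC mulrDl mul1r mulVf ?gt_eqF.
have xV : xi^-1 < 1 by rewrite invf_lt1.
have xV0 : 0 < xi^-1 by rewrite invr_gt0.
have s0 : 0 < s by rewrite sE; lra.
have s1 : 0 < 1 - s by rewrite sE; lra.
have s01 : 0 < s < 1 by apply/andP; split=> //; lra.
have Hs : nprime n * (1 + excess p alpha js) <= n%:R * (s * xi).
  rewrite /nprime mulrAC mulrC ler_wpM2l// sxi.
  have x0 := excess_ge0 n p q alpha js alpha_ge1 jsP.
  have xK := excess_le.
  have p0 : 0 <= n%:R `^ (- (1 / 3)) :> R by exact: powR_ge0.
  have KV : 0 < K^-1 by rewrite invr_gt0.
  have KV1 : K^-1 <= 1 by rewrite invf_le1.
  have K6 : 6 * K^-1 <= xi - 1.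
    move: HK; rewrite ler_pdivrMr; last lra.
    by rewrite ler_pdivrMr// mulrC.
  have : (1 + n%:R `^ (- (1 / 3))) * (1 + excess p alpha js) <= (1 + K^-1) * (1 + K^-1).
    by apply: ler_pM; lra.
  have : K^-1 * K^-1 <= K^-1 * 1 by rewrite ler_pM2l.
  lra.
apply: (le_trans (minimax_risk_upper_finite n p q n_gt0 p_gt1 sq q_sorted q_ge
  alpha xi js alpha_ge1 xi_gt0 jsP s s01 r_ge1 Hs)).
have E1 := expRN_exponent_le s s0.
have E2 := expRN_exponent_le (1 - s) s1.
have E3 : 4 / alpha <= 4 / K by rewrite ler_pM2l// lef_pV2 ?posrE//; have := alpha_ge1; lra.
rewrite -/eps -/V -/G; lra.
Qed.

Lemma jstar_le_n : (js < n)%N.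
Proof.
have H := sorted_coord_le p q sq q_sorted js.
have n0 : 0 < n%:R :> R by rewrite ltr0n.
have : js.+1%:R / n%:R <= 1 :> R by apply: le_trans H; rewrite ler_wpM2l.
by rewrite ler_pdivrMr// mul1r ler_nat.
Qed.

(** Since j* < n, epsilon_sqr_le gives L eps^2 <= 8 (1 + eps), where L >= K. *)
Lemma epsilon_small (u : R) : 0 < u <= 1 -> xi < 1 -> xi * (1 + excess p alpha js) <= 1 ->
  16 / u ^+ 2 <= K -> eps <= u.
Proof.
move=> /andP[u0 u1] xi1 Hx HK; have K0 := K_gt0.
have [e0 _] := bernstein_exponent_ge n p q n_gt0 p_gt1 sq q_sorted q_ge eps r_ge1.
have H := epsilon_sqr_le n p q n_gt0 sq q_sorted q_ge alpha xi js alpha_ge1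
  xi_gt0 jsP 1 (lexx _) Hx e0.
have js0 : (0 < js)%N by case: jsP => /andP[].
have KL := L_ge; have K1 := K_ge1.
have L0 : 0 < L by lra.
have nL : L ^+ 2 / 2 <= n%:R.
  have H1 : L ^+ 2 <= 2 * js%:R by apply: ln_sqr_le; rewrite ler1n.
  have : js%:R <= n%:R :> R by rewrite ler_nat ltnW// jstar_le_n.
  lra.
rewrite leNgt; apply/negP => ue.
have P1 : L ^+ 2 / 2 * eps ^+ 2 <= n%:R * eps ^+ 2 by rewrite ler_wpM2r ?sqr_ge0.
have {}P1 : L * (L * eps ^+ 2) <= L * (8 * (1 + eps)).
  have : (1 + eps) * (1 + L) <= (1 + eps) * (2 * L) by rewrite ler_wpM2l//; lra.
  rewrite -/eps -/L in H; lra.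
have P2 : L * eps ^+ 2 <= 8 * (1 + eps) by rewrite -(ler_pM2l L0).
have P3 : (1 + eps) * u <= 2 * eps.
  have : eps * u <= eps * 1 by rewrite ler_pM2l.
  lra.
have P4 : eps * (L * eps * u) <= eps * 16.
  have : L * eps ^+ 2 * u <= 8 * (1 + eps) * u by rewrite ler_pM2r.
  lra.
have P5 : L * eps * u <= 16 by rewrite -(ler_pM2l e0).
have P6 : 16 <= L * u ^+ 2.
  move: HK; rewrite ler_pdivrMr ?exprn_gt0// => /le_trans; apply.
  by rewrite ler_wpM2r ?sqr_ge0.
have : L * u * u < L * u * eps by rewrite ltr_pM2l// mulr_gt0.
lra.
Qed.

(** With xi' = (1 + xi) / 2 = 1 - 32 u, the choices eta = u and d = 2 u give the
exponent xi' (1 + 4 eta + 8 d) <= 1 - 12 u, so that the diagonal term decays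
like a power of j*. *)
Lemma minimax_risk_lower_regime (u c : R) : u = (1 - xi) / 64 ->
  xi < 1 -> 0 < c -> 2 / (1 - xi) <= K -> 16 / u ^+ 2 <= K ->
  1 - c / 2 - (64 / u ^+ 2 + 2 * expR 1 / (12 * u)) / K / (2 * c) <= minimax_risk eps n q.
Proof.
move=> uE xi1 c0 HK HKu; have K0 := K_gt0; have xi0 := xi_gt0; have K1 := K_ge1.
have [e0 _] := bernstein_exponent_ge n p q n_gt0 p_gt1 sq q_sorted q_ge eps r_ge1.
have js0 : (0 < js)%N by case: jsP => /andP[].
have J0 : 0 < js%:R :> R by rewrite ltr0n.
have u0 : 0 < u by rewrite uE; lra.
have u1 : u <= 1 / 64 by rewrite uE; lra.
pose xi' := (1 + xi) / 2.
have x0 := excess_ge0 n p q alpha js alpha_ge1 jsP.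
have Hx : xi * (1 + excess p alpha js) <= xi'.
  have : 2 * K^-1 <= 1 - xi.
    by move: HK; rewrite ler_pdivrMr ?ler_pdivrMr// 1?mulrC//; lra.
  have := excess_le.
  have : xi * excess p alpha js <= 1 * excess p alpha js by rewrite ler_wpM2r//; lra.
  rewrite /xi'; lra.
have xi'1 : xi' <= 1 by rewrite /xi'; lra.
have eu : eps <= u.
  apply: epsilon_small => //; [by rewrite u0; lra|lra].
have ln1 := ln_le_sub1 js%:R J0.
have u2 : u ^+ 2 <= u * (1 / 64) by rewrite expr2 ler_pM2l.
have KL := L_ge.
have j4 : 4 / js%:R <= u.
  rewrite ler_pdivrMr//.
  move: HKu; rewrite ler_pdivrMr ?exprn_gt0// => HKu.
  have : K * u ^+ 2 <= js%:R * u ^+ 2.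
    by rewrite ler_wpM2r ?sqr_ge0//; move: ln1; rewrite -/L; lra.
  have : js%:R * u ^+ 2 <= js%:R * (u * (1 / 64)) by rewrite ler_pM2l.
  lra.
have u01 : 0 < u <= 1 by rewrite u0; lra.
have d1 : 2 * u <= 1 / 2 by lra.
have Hd : 4 / js%:R + eps <= 2 * u by lra.
apply: le_trans (minimax_risk_lower_finite n p q n_gt0 p_gt1 sq q_sorted q_ge
  alpha xi js alpha_ge1 xi_gt0 jsP xi' xi'1 Hx e0 u (2 * u) c r_ge1 u01 c0 d1 Hd).
rewrite -/eps -/V -/G -/L.
rewrite lerD2l lerN2; apply: ler_wpM2r; first by rewrite invr_ge0; lra.
rewrite [leRHS]mulrDl; apply: lerD.
  by have := expRN_exponent_le u u0; lra.
rewrite -[leLHS]mulrA -[leRHS]mulrA -[X in _ <= X]mulrA ler_pM2l//.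
have -> : js%:R = expR L by rewrite lnK// posrE.
rewrite -expRN -expRD.
have TH : xi' * (1 + (4 * u + 8 * (2 * u))) * (1 + L) - L <= 1 - 12 * u * L.
  have : xi' * (1 + (4 * u + 8 * (2 * u))) <= 1 - 12 * u.
    have : xi' * (20 * u) <= 1 * (20 * u) by rewrite ler_wpM2r//; lra.
    have : xi' = 1 - 32 * u by rewrite /xi' uE; lra.
    lra.
  have L0 : 0 <= 1 + L by have := K_ge1; lra.
  move=> /(ler_wpM2r L0); lra.
apply: (@le_trans _ _ (expR (1 - 12 * u * L))).
  by rewrite ler_expR; move: TH; lra.
rewrite expRD ler_wpM2l ?expR_ge0//.
have Lp : 0 < L by lra.
have P : 0 < 12 * u * L by rewrite !mulr_gt0.
apply: le_trans (expRN_le_inv _ P) _.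
rewrite -invfM lef_pV2 ?posrE ?mulr_gt0//.
by rewrite ler_pM2l// mulr_gt0.
Qed.

End Regime.

(** One constant K measures how far into the asymptotic regime n is; the risk
bounds above are 0 and 1 up to O(1 / K). *)
Lemma eventually_regime (R : realType) (p : nat -> nat)
  (q0 : forall n : nat, 'rV[R]_(p n))
  (alpha : nat -> R) (jstar : nat -> nat) (xi K : R) : 1 <= K ->
  alpha n @[n --> \oo] --> +oo ->
  (\forall n \near \oo, is_jstar n (q0 n) (alpha n) (jstar n)) ->
  ln (jstar n)%:R / (ln (alpha n) * ln (ln (jstar n)%:R)) @[n --> \oo] --> +oo ->
  epsilon xi n (q0 n) / Num.sqrt (qmax (q0 n) * (1 - qmax (q0 n)) / n%:R)
     @[n --> \oo] --> +oo ->
  \forall n \near \oo, (0 < n)%N /\ exists js : 'I_(p n),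
    [/\ [/\ (1 < p n)%N, is_jstar n (q0 n) (alpha n) js & K <= alpha n],
      excess (p n) (alpha n) js <= K^-1, K <= ln js%:R,
      K <= epsilon xi n (q0 n) / Num.sqrt (qmax (q0 n) * (1 - qmax (q0 n)) / n%:R) &
      n%:R `^ (- (1 / 3)) <= K^-1].
Proof.
move=> K1 /cvgryPge alpha_oo jstarP /cvgryPge T_oo /cvgryPge r_oo.
near=> n.
have n_gt0 : (0 < n)%N by near: n; exact: nbhs_infty_gt.
have jP : is_jstar n (q0 n) (alpha n) (jstar n) by near: n.
have /andP[j1 jp] := proj1 jP.
have aK : K <= alpha n by near: n; exact: alpha_oo.
have a_e : expR 1 <= alpha n by near: n; exact: alpha_oo.
have a1 : 1 <= ln (alpha n).
  rewrite -[leLHS](expRK 1) ler_ln ?posrE ?expR_gt0//; lra.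
have T : 32 * K ^+ 2 / ln (ln 3) <= ln (jstar n)%:R / (ln (alpha n) * ln (ln (jstar n)%:R)).
  by near: n; exact: T_oo.
have [KL ex] := jstar_growth (jstar n) _ _ K1 a1 j1 T.
split=> //; exists (Ordinal jp); split=> //.
- by split=> //; exact: leq_ltn_trans jp.
- by near: n; exact: r_oo.
- apply: powR_third_le => //; near: n; exact: nbhs_infty_ger.
Unshelve. all: by end_near.
Qed.

Theorem theorem6 (R : realType) (p : nat -> nat)
  (q0 : forall n : nat, 'rV[R]_(p n))
  (alpha : nat -> R) (jstar : nat -> nat) (xi : R)
  (q0_simplex : forall n, (0 < n)%N -> simplex (q0 n))
  (q0_sorted : forall n, (0 < n)%N ->
     forall i j : 'I_(p n), (i <= j)%N -> q0 n 0 j <= q0 n 0 i)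
  (q0_ge : forall n, (0 < n)%N -> forall j : 'I_(p n), n%:R^-1 <= q0 n 0 j)
  (alpha_oo : alpha n @[n --> \oo] --> +oo)
  (jstarP : \forall n \near \oo, is_jstar n (q0 n) (alpha n) (jstar n))
  (xi_gt0 : 0 < xi)
  (jstar_oo : ln (jstar n)%:R / (ln (alpha n) * ln (ln (jstar n)%:R))
     @[n --> \oo] --> +oo)
  (eps_oo : epsilon xi n (q0 n) /
       Num.sqrt (qmax (q0 n) * (1 - qmax (q0 n)) / n%:R)
     @[n --> \oo] --> +oo) :
  (1 < xi ->
     (ln (jstar n)%:R / (n%:R * qminus (q0 n) (jstar n)) @[n --> \oo] --> (0 : R)) \/
     (ln (jstar n)%:R / (n%:R * qminus (q0 n) (jstar n)) @[n --> \oo] --> +oo) ->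
     minimax_risk (epsilon xi n (q0 n)) n (q0 n) @[n --> \oo] --> (0 : R)) /\
  (xi < 1 ->
     (ln (jstar n)%:R / (n%:R * qminus (q0 n) (jstar n)) @[n --> \oo] --> (0 : R)) \/
     (ln (jstar n)%:R / (n%:R * qminus (q0 n) (jstar n)) @[n --> \oo] --> +oo) ->
     minimax_risk (epsilon xi n (q0 n)) n (q0 n) @[n --> \oo] --> (1 : R)).
Proof.
have xi0 := xi_gt0.
have base n : (0 < n)%N ->
    0 <= minimax_risk (epsilon xi n (q0 n)) n (q0 n) <= 1.
  move=> /q0_simplex sq; rewrite minimax_risk_le1// andbT.
  by apply: minimax_risk_ge => phi; exact: test_risk_ge0.
split=> [xi1 _|xi1 _].
- pose s : R := (1 + xi^-1) / 2.
  have xV : xi^-1 < 1 by rewrite invf_lt1.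
  have xV0 : 0 < xi^-1 by rewrite invr_gt0.
  pose C := 4 + 32 / s ^+ 2 + 32 / (1 - s) ^+ 2.
  have C0 : 0 <= C by rewrite !addr_ge0 ?divr_ge0 ?sqr_ge0.
  apply/cvgrPdist_le => e e0.
  have Ce : 0 <= C / e by rewrite divr_ge0// ltW.
  have X0 : 0 <= 6 / (xi - 1) by rewrite divr_ge0//; lra.
  (* The summands of K are the separate lower bounds required of it. *)
  pose K := 1 + C / e + 6 / (xi - 1).
  have K1 : 1 <= K by rewrite /K; lra.
  have := eventually_regime R p q0 alpha jstar xi K K1 alpha_oo jstarP jstar_oo eps_oo.
  apply: filterS => n [n0 [js [[p1 jP aK] exK KL rK nK]]].
  have /andP[r0 _] := base n n0.
  rewrite sub0r normrN ger0_norm//.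
  have := minimax_risk_upper_regime n (p n) (q0 n) n0 p1 (q0_simplex n n0)
    (q0_sorted n n0) (q0_ge n n0) (alpha n) xi js K jP xi_gt0 K1 aK exK rK s erefl xi1.
  move=> /(_ _ nK)/le_trans; apply; first by rewrite /K; lra.
  rewrite -/C ler_pdivrMr; last lra.
  by rewrite mulrC -ler_pdivrMr// /K; lra.
- pose u : R := (1 - xi) / 64.
  have u0 : 0 < u by rewrite /u; lra.
  pose C := 64 / u ^+ 2 + 2 * expR 1 / (12 * u).
  have C0 : 0 <= C.
    apply: addr_ge0; first by rewrite divr_ge0// sqr_ge0.
    by rewrite divr_ge0 ?mulr_ge0 ?expR_ge0//; lra.
  apply/cvgrPdist_le => e e0.
  have Ce : 0 <= C / e ^+ 2 by rewrite divr_ge0// sqr_ge0.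
  have X0 : 0 <= 2 / (1 - xi) by rewrite divr_ge0//; lra.
  have Y0 : 0 <= 16 / u ^+ 2 by rewrite divr_ge0// sqr_ge0.
  pose K := 1 + C / e ^+ 2 + 2 / (1 - xi) + 16 / u ^+ 2.
  have K1 : 1 <= K by rewrite /K; lra.
  have := eventually_regime R p q0 alpha jstar xi K K1 alpha_oo jstarP jstar_oo eps_oo.
  apply: filterS => n [n0 [js [[p1 jP aK] exK KL rK _]]].
  have /andP[_ r1] := base n n0.
  rewrite ger0_norm ?subr_ge0//.
  have := minimax_risk_lower_regime n (p n) (q0 n) n0 p1 (q0_simplex n n0)
    (q0_sorted n n0) (q0_ge n n0) (alpha n) xi js K jP xi_gt0 K1 aK exK KL rK u e erefl xi1 e0.
  move=> H.
  have : C / K / (2 * e) <= e / 2.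
    have K0 : 0 < K by lra.
    rewrite ler_pdivrMr ?mulr_gt0// ler_pdivrMr//.
    have -> : e / 2 * (2 * e) * K = K * e ^+ 2 by field.
    by rewrite -ler_pdivrMr ?exprn_gt0// /K; lra.
  have : 1 - e / 2 - C / K / (2 * e) <= minimax_risk (epsilon xi n (q0 n)) n (q0 n).
    by apply: H; rewrite /K; lra.
  lra.
Qed.
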